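(* Let $P(t)(x)=x^n-a_1(t)x^{n-1}+\dots+(-1)^na_n(t)$, $t\in\mathbb R$, where each $a_i:\mathbb R\to\mathbb R$ is of class $C^n$ and all roots of $P(t)$ are real for every $t$. Then there exist differentiable functions $x_1,\dots,x_n:\mathbb R\to\mathbb R$ such that $P(t)(x)=\prod_{i=1}^n(x-x_i(t))$ for all $t\in\mathbb R$. *)

(* Defs.v *)
From HB Require Import structures.
From mathcomp Require Import all_boot all_order all_algebra.
From mathcomp Require Import all_classical all_reals all_analysis.
Set Implicit Arguments. Unset Strict Implicit. Unset Printing Implicit Defensive.
Import Order.TTheory GRing.Theory Num.Theory numFieldNormedType.Exports.
Local Open Scope ring_scope.

Definition classC (R : realType) (n : nat) (f : R -> R) : Prop :=
  (forall k : nat, (k < n)%N -> forall x : R, derivable (derive1n k f) x 1)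
  /\ continuous (fun x : R => derive1n n f x : R).

Definition Pt (R : realType) (n : nat) (a : nat -> R -> R) (t : R) : {poly R} :=
  'X^n + \sum_(1 <= i < n.+1) (((-1) ^+ i * a i t) *: 'X^(n - i)).

Definition all_roots_real (R : realType) (p : {poly R}) : Prop :=
  exists2 r : seq R, size r = (size p).-1 & p = \prod_(z <- r) ('X - z%:P).

(* Main.v *)
Require Import Defs.
From HB Require Import structures.
From mathcomp Require Import all_boot all_order all_algebra.
From mathcomp Require Import all_classical all_reals all_analysis.
From mathcomp Require Import fingroup perm ring lra.
Import Order.TTheory GRing.Theory Num.Theory numFieldNormedType.Exports.
Local Open Scope ring_scope.
Local Open Scope classical_set_scope.
Set Implicit Arguments. Unset Strict Implicit. Unset Printing Implicit Defensive.

(** Let [y_1 <= ... <= y_n] be the sorted roots; they are continuous. Fix [q]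
and a value [v] taken by exactly [k] of the [y_i] at [q]. Positivity of the sum
of the squares of the roots near [v], together with the Taylor expansions of
the coefficients of [P(q + h)(x + v)], forces these roots to be [v + O(h)], and
then forces [prod (w - (y_i(q + h) - v) / h)] to converge, for every [w], as
[h] tends to [0] from either side. Hence the [y_i] have one-sided derivatives
at [q], and inside each such cluster the left derivatives are a permutation of
the right ones.

This matching property alone allows one to relabel the [y_i] differentiably, by
induction on the number of branches. Away from the closed set where all
branches coincide they split locally into two smaller families. Where all of
them coincide with different slopes the point is isolated in that set, and the
solutions on its two sides are glued there. Where they all coincide with a
common slope, every labelling is differentiable. Local solutions glue to a
solution on each component of an open set because a differentiable labelling
on one side of a point always has one-sided derivatives at that point: by the
intermediate value theorem it cannot oscillate between two slopes. *)

(** * One-sided first-order expansions *)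

(* [v] is the limit of [f] at [0] from the right; the value [f 0] plays no role. *)
Definition osd (R : realType) (f : R -> R) (v d : R) :=
  forall e, 0 < e -> \forall h \near 0^'+, `|f h - v - d * h| <= e * h.

Section OneSided.
Variable R : realType.
Implicit Types (f g : R -> R) (v d : R).

Lemma osd_near f g v d : (\forall h \near 0^'+, f h = g h) ->
  osd f v d -> osd g v d.
Proof.
move=> fg fd e e0; have := fd e e0; apply: filter_app; near=> h => fh.
by have <- : f h = g h by near: h; exact: fg.
Unshelve. all: by end_near. Qed.

Lemma osdN f v d : osd f v d -> osd (fun h => - f h) (- v) (- d).
Proof.
move=> fd e e0; near=> h.
have -> : - f h - - v - - d * h = - (f h - v - d * h) by ring.
by rewrite normrN; near: h; exact: fd.
Unshelve. all: by end_near. Qed.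

Lemma osdB f g v d v' d' : osd f v d -> osd g v' d' ->
  osd (fun h => f h - g h) (v - v') (d - d').
Proof.
move=> fd gd e e0; have e2 : 0 < e / 2 by rewrite divr_gt0.
have := fd _ e2; have := gd _ e2; apply: filter_app2; near=> h => gh fh.
have -> : f h - g h - (v - v') - (d - d') * h =
  (f h - v - d * h) - (g h - v' - d' * h) by ring.
apply: (le_trans (ler_normB _ _)).
by rewrite [e]splitr mulrDl lerD.
Unshelve. all: by end_near. Qed.

Lemma osd_cst v d : osd (fun h => v + d * h) v d.
Proof.
move=> e e0; near=> h.
have -> : v + d * h - v - d * h = 0 by ring.
by rewrite normr0 mulr_ge0 ?ltW//; near: h; exact: nbhs_right_gt.
Unshelve. all: by end_near. Qed.

Lemma osd_bound f v d : osd f v d ->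
  \forall h \near 0^'+, `|f h - v| <= (`|d| + 1) * h.
Proof.
move=> fd; have := fd 1 ltr01; apply: filter_app; near=> h => fh.
have h0 : 0 < h by near: h; exact: nbhs_right_gt.
have -> : f h - v = (f h - v - d * h) + d * h by ring.
apply: (le_trans (ler_normD _ _)).
by rewrite normrM (gtr0_norm h0) mulrDl addrC lerD2l.
Unshelve. all: by end_near. Qed.

Lemma nearp_mul_lt (K c : R) : 0 < c -> \forall h \near 0^'+, K * h < c.
Proof.
move=> c0; near=> h.
have h0 : 0 < h by near: h; exact: nbhs_right_gt.
have hc : h < c / (`|K| + 1).
  by near: h; apply: nbhs_right_lt; rewrite divr_gt0// ltr_wpDl.
apply: (@le_lt_trans _ _ ((`|K| + 1) * h)).
  by rewrite ler_pM2r// (le_trans (ler_norm _))// lerDl.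
by rewrite mulrC -ltr_pdivlMr// ltr_wpDl.
Unshelve. all: by end_near. Qed.

Lemma osd_cvg f v d : osd f v d ->
  forall e, 0 < e -> \forall h \near 0^'+, `|f h - v| < e.
Proof.
move=> /osd_bound fb e e0; have := fb; have := nearp_mul_lt (`|d| + 1) e0.
apply: filter_app2; near=> h => h1 h2; exact: le_lt_trans h2 h1.
Unshelve. all: by end_near. Qed.

(** The leading term wins: a nonzero [v] by convergence, otherwise a nonzero slope, the error being
    at most half of it. *)
Lemma osd_neq0 f v d : osd f v d -> (v != 0) || (d != 0) ->
  \forall h \near 0^'+, f h != 0.
Proof.
move=> fd; have [v0|v0] := eqVneq v 0 => /=.
  move=> d0; have := fd (`|d| / 2); rewrite divr_gt0 ?normr_gt0// => /(_ isT).
  apply: filter_app; near=> h => fh; apply/negP => /eqP f0; move: fh.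
  have h0 : 0 < h by near: h; exact: nbhs_right_gt.
  rewrite f0 v0 subr0 sub0r normrN normrM (gtr0_norm h0) ler_pM2r//.
  have : 0 < `|d| by rewrite normr_gt0.
  lra.
move=> _; have := osd_cvg fd; have : 0 < `|v| by rewrite normr_gt0.
move=> nv /(_ _ nv); apply: filter_app; near=> h => fh; apply/negP => /eqP f0.
by move: fh; rewrite f0 sub0r normrN ltxx.
Unshelve. all: by end_near. Qed.

(** Both expansions use a positive increment [h], so the left-hand one carries the slope [- d]. *)
Lemma derivableP_osd f (t : R) : derivable f t 1 <->
  exists d, osd (fun h => f (t + h)) (f t) d /\
            osd (fun h => f (t - h)) (f t) (- d).
Proof.
pose g (d h : R) := f (h *: 1 + t) - f t - d * h.
have E d h : h != 0 -> `|d - h^-1 *: (f (h *: 1 + t) - f t)| = `|g d h| / `|h|.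
  move=> h0; rewrite -normfV -normrM -normrN; congr `|_|.
  by rewrite /g /GRing.scale/=; field.
have rE (h : R) : h *: 1 + t = t + h by rewrite /GRing.scale/= mulr1 addrC.
have nr (P : R -> Prop) : (\forall h \near 0^', P h) <->
    (\forall h \near 0^'+, P h) /\ (\forall h \near 0^'+, P (- h)).
  have lE : (\forall h \near 0^'-, P h) <-> \forall h \near 0^'+, P (- h).
    rewrite nbhs_left0P; split; apply: filterS => h; first by rewrite sub0r.
    by rewrite sub0r.
  split=> [[e e0 eP]|[rP /lE lP]].
    split; [|apply/lE]; (exists e; first exact: e0) => h hb h0; apply: eP => //=.
      by rewrite gt_eqF.
    by rewrite lt_eqF.
  have [e e0 eP] := rP; have [e' e0' eP'] := lP.
  exists (Num.min e e'); first by rewrite /= lt_min e0.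
  move=> h /=; rewrite lt_min => /andP[h1 h2].
  by rewrite neq_lt => /orP[h0|h0]; [apply: eP'|apply: eP].
split.
  move=> /cvg_ex[d /cvgrPdist_le fd]; exists d; split => e /fd /nr[]; rewrite /=.
    move=> + _; have := @nbhs_right_gt R 0; apply: filter_app2; near=> h => h0.
    by rewrite E ?gt_eqF// /g rE (gtr0_norm h0) ler_pdivrMr.
  move=> _; have := @nbhs_right_gt R 0; apply: filter_app2; near=> h => h0.
  rewrite E ?oppr_eq0 ?gt_eqF// /g rE normrN (gtr0_norm h0).
  by rewrite ler_pdivrMr// mulrN mulNr.
move=> [d [fr fl]]; apply/cvg_ex; exists d; apply/cvgrPdist_le => e e0.
apply/nr; split; near=> h; have h0 : 0 < h by near: h; exact: nbhs_right_gt.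
  rewrite E ?gt_eqF// /g rE (gtr0_norm h0) ler_pdivrMr//; near: h; exact: fr.
rewrite E ?oppr_eq0 ?gt_eqF// /g rE normrN (gtr0_norm h0) ler_pdivrMr// mulrN -mulNr.
near: h; exact: fl.
Unshelve. all: by end_near. Qed.

End OneSided.

(** * Continuous selections among finitely many branches *)

Lemma neg_of_neq0 (R : realType) (X : R -> R) (r h1 h2 : R) :
  (forall h, 0 < h < r -> {for h, continuous X}) ->
  (forall h, 0 < h < r -> X h != 0) ->
  0 < h1 < r -> 0 < h2 < r -> X h1 < 0 -> X h2 < 0.
Proof.
move=> cX nX h1r h2r X1; rewrite ltNge; apply/negP => X2.
have [c [cr Xc]] : exists c, 0 < c < r /\ X c = 0.
  pose a := Num.min h1 h2; pose b := Num.max h1 h2.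
  have ab : a <= b by rewrite /a /b ge_min !le_max lexx.
  have abr h : h \in `[a, b]%R -> 0 < h < r.
    rewrite in_itv/= /a /b; move: h1r h2r => /andP[? ?] /andP[? ?] /andP[ah hb].
    apply/andP; split; first by apply: lt_le_trans ah; rewrite lt_min; apply/andP.
    by apply: (le_lt_trans hb); rewrite gt_max; apply/andP.
  have [| |c cab Xc] := @IVT R X a b 0 ab.
  - apply: continuous_in_subspaceT => h /set_mem hab; exact/cX/abr.
  - rewrite /a /b; case: (leP h1 h2) => _; rewrite ?(ge_min, le_max) X2 (ltW X1);
    by rewrite ?orbT.
  by exists c; split => //; exact: abr.
by move/eqP: (nX _ cr).
Qed.

Section Selection.
Variables (R : realType) (T : finType).
Implicit Types (S : {set T}) (Y : T -> R -> R) (v d : T -> R).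

Lemma selection_lt S Y v d (X : R -> R) (r : R) (j0 : T) :
  0 < r -> (forall h, 0 < h < r -> {for h, continuous X}) ->
  (forall j, j \in S -> osd (Y j) (v j) (d j)) ->
  (forall h, 0 < h < r -> exists2 j, j \in S & X h = Y j h) ->
  j0 \in S -> ~ (\forall h \near 0^'+, X h <> Y j0 h) ->
  forall c, 0 < c -> \forall h \near 0^'+, X h - v j0 - d j0 * h < c * h.
Proof.
move=> r0 cX Yd XY j0S freq c c0.
(* Near [0], the graph of [X] cannot cross the line of slope [d j0 + m]
   because no [Y j] is tangent to it. *)
have [m [m0 mc md]] : exists m, [/\ 0 < m, m < c & forall j, d j != d j0 + m].
  have dm (j : T) : \forall m \near (0 : R)^'+, d j != d j0 + m.
    case: (leP (d j) (d j0)) => dj; near=> m; have m0 : 0 < m by near: m; exact: nbhs_right_gt.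
      by rewrite lt_eqF// (le_lt_trans dj)// ltrDl.
    rewrite gt_eqF// -ltrBrDl; near: m; apply: nbhs_right_lt; by rewrite subr_gt0.
  have := filter_ex (filterI (filterI (nbhs_right_gt (0:R)) (nbhs_right_lt c0))
    (filter_forall _ dm)).
  by move=> [m /= [[]]]; exists m.
have sep : \forall h \near 0^'+, forall j, j \in S -> Y j h - (v j0 + (d j0 + m) * h) != 0.
  apply: filter_forall => j; case: (boolP (j \in S)) => jS; last by near=> h.
  have := osd_neq0 (osdB (Yd j jS) (osd_cst (v j0) (d j0 + m))).
  by rewrite [X in _ || ~~ X]subr_eq0 md orbT => /(_ isT); apply: filterS.
have [r1 r10 r1P] := sep.
pose rr := Num.min r r1.
have rr0 : 0 < rr by rewrite lt_min r0.
pose Z h := X h - (v j0 + (d j0 + m) * h).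
have cZ h : 0 < h < rr -> {for h, continuous Z}.
  rewrite lt_min => /and3P[h0 hr _].
  apply: cvgB; first by apply: cX; rewrite h0.
  by apply: cvgD; [exact: cvg_cst|apply: cvgM; [exact: cvg_cst|exact: cvg_id]].
have nZ h : 0 < h < rr -> Z h != 0.
  rewrite lt_min => /and3P[h0 hr hr1].
  have [|j jS Xj] := XY h; first by rewrite h0.
  by rewrite /Z Xj; apply: r1P => //=; rewrite sub0r normrN gtr0_norm.
(* Points where [X] equals [Y j0] accumulate at [0]. At one of them [Y j0] is within [m / 2 * h] of
   its tangent, hence below the line of slope [d j0 + m]. *)
have [h1 [h1r Z1]] : exists h1, 0 < h1 < rr /\ Z h1 < 0.
  apply: contrapT => /forallNP nex; apply: freq.
  have := Yd j0 j0S (m / 2); rewrite divr_gt0// => /(_ isT).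
  apply: filter_app; near=> h => Yh Xh; apply: (nex h).
  have h0 : 0 < h by near: h; exact: nbhs_right_gt.
  split; first by rewrite h0; near: h; exact: nbhs_right_lt.
  move: Yh; rewrite -Xh ler_norml => /andP[_].
  have : 0 < m * h by rewrite mulr_gt0.
  rewrite /Z; nra.
near=> h; have h0 : 0 < h by near: h; exact: nbhs_right_gt.
have : Z h < 0.
  apply: (neg_of_neq0 cZ nZ h1r _ Z1); rewrite h0.
  by near: h; exact: nbhs_right_lt.
have : m * h <= c * h by rewrite ler_pM2r// ltW.
rewrite /Z; lra.
Unshelve. all: by end_near. Qed.

(** The lower bound is the upper bound for the negated branches. This is how oscillation between two
    slopes is ruled out. *)
Lemma selection_osd S Y v d (X : R -> R) (r : R) (j0 : T) :
  0 < r -> (forall h, 0 < h < r -> {for h, continuous X}) ->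
  (forall j, j \in S -> osd (Y j) (v j) (d j)) ->
  (forall h, 0 < h < r -> exists2 j, j \in S & X h = Y j h) ->
  j0 \in S -> ~ (\forall h \near 0^'+, X h <> Y j0 h) ->
  osd X (v j0) (d j0).
Proof.
move=> r0 cX Yd XY j0S freq e e0.
have up := selection_lt r0 cX Yd XY j0S freq e0.
have dn : \forall h \near 0^'+, - X h - - v j0 - - d j0 * h < e * h.
  apply: (@selection_lt S (fun j h => - Y j h) (fun j => - v j) (fun j => - d j)
    (fun h => - X h) r j0 r0) => //.
  - by move=> h /cX; exact: cvgN.
  - by move=> j jS; apply/osdN/Yd.
  - by move=> h /XY[j jS ->]; exists j.
  - by move=> nf; apply: freq; apply: filterS nf => h + Xh; rewrite Xh.
move: up dn; apply: filter_app2; near=> h => h1 h2.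
rewrite ler_norml; apply/andP; split; lra.
Unshelve. all: by end_near. Qed.

(** Relabellings of a subfamily [S] are permutations of the whole of [T] preserving [S], so that
    they compose and invert freely. *)
Definition stable S (p : {perm T}) := forall i, (p i \in S) = (i \in S).

Lemma stableM S p q : stable S p -> stable S q -> stable S (p * q)%g.
Proof. by move=> ps qs i; rewrite permM qs ps. Qed.

Lemma stableV S p : stable S p -> stable S (p^-1)%g.
Proof. by move=> ps i; rewrite -ps permKV. Qed.

Lemma stable1 S : stable S 1%g.
Proof. by move=> i; rewrite perm1. Qed.

(* The common relabelling [p] is any value taken by [s] arbitrarily close to [0]. *)
Lemma selections_osd S Y v d (X : T -> R -> R) (s : R -> {perm T}) (r : R) :
  0 < r -> (forall i, i \in S -> forall h, 0 < h < r -> {for h, continuous (X i)}) ->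
  (forall j, j \in S -> osd (Y j) (v j) (d j)) ->
  (forall h, 0 < h < r -> stable S (s h)) ->
  (forall i, i \in S -> forall h, 0 < h < r -> X i h = Y (s h i) h) ->
  exists2 p, stable S p & forall i, i \in S -> osd (X i) (v (p i)) (d (p i)).
Proof.
move=> r0 cX Yd sS XY.
(* There are finitely many permutations, so [s] cannot eventually avoid each of them. *)
have [p pfreq] : exists p, ~ \forall h \near 0^'+, s h <> p.
  apply: contrapT => /forallNP nex.
  have nea : \forall h \near (0 : R)^'+, forall p, s h <> p.
    by apply: filter_forall => p; apply: contrapT => /nex.
  have ex := @filter_ex R _ (at_right_proper_filter (0 : R)) _ nea.
  case: ex => h hne.
  exact: (hne (s h)).
have near_r : \forall h \near 0^'+, 0 < h < r.
  apply: filterS2 (nbhs_right_gt 0) (nbhs_right_lt r0) => h h0 hr.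
  by rewrite h0.
have pS : stable S p.
  apply: contrapT => npS; apply: pfreq; apply: filterS near_r => h hr sp.
  by apply: npS; rewrite -sp; exact: sS.
exists p => // i iS.
have XYi h : 0 < h < r -> exists2 j, j \in S & X i h = Y j h.
  by move=> hr; exists (s h i); [rewrite sS|exact: XY].
apply: (selection_osd r0 (cX i iS) Yd XYi); first by rewrite pS.
move=> nf; apply: pfreq; move: near_r nf; apply: filter_app2; near=> h => hr nX sp.
by apply: nX; rewrite XY// sp.
Unshelve. all: by end_near. Qed.

End Selection.

(** * Gluing solutions *)

Section Gluing.
Variables (R : realType) (T : finType) (S : {set T}) (y : T -> R -> R).
Implicit Types (s : R -> {perm T}) (q t : R) (U V : set R).

(* The half-tangents arriving at [q] from the left continue, up to relabelling,
   as those leaving to the right; [dl i] is minus the left derivative. *)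
Definition matched q := exists dr dl : T -> R, exists p : {perm T},
  [/\ stable S p,
      forall i, i \in S -> osd (fun h => y i (q + h)) (y i q) (dr i),
      forall i, i \in S -> osd (fun h => y i (q - h)) (y i q) (dl i) &
      forall i, i \in S -> y (p i) q = y i q /\ dr (p i) = - dl i].

(** The relabelling may jump from point to point; only the relabelled branches have to be
    differentiable at [t]. *)
Definition solat s t := stable S (s t) /\
  forall i, i \in S -> derivable (fun u => y (s u i) u) t 1.

Lemma solat_near s s' t : (\forall u \near t, s u = s' u) ->
  solat s t -> solat s' t.
Proof.
move=> ss' [st sd]; have stt := nbhs_singleton ss'.
split=> [|i iS]; first by rewrite -stt.
apply: near_eq_derivable (sd i iS).
by apply: filterS ss' => u ->.
Qed.

(** Permutations compose from left to right, so a constant factor on the left merely renumbers the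
    solution curves. *)
Lemma solatM s t (p : {perm T}) : stable S p -> solat s t ->
  solat (fun u => p * s u)%g t.
Proof.
move=> pS [st sd]; split; first exact: stableM.
move=> i iS; under eq_fun do rewrite permM; apply: sd; by rewrite pS.
Qed.

Lemma solat_continuous s t i : solat s t -> i \in S ->
  {for t, continuous (fun u => y (s u i) u)}.
Proof.
move=> [_ sd] iS; apply: differentiable_continuous.
exact/derivable1_diffP/sd.
Qed.

(** Each one-sided solution has one-sided slopes at [q], and a constant renumbering of the right one
    makes them agree with the left ones. The left solution is kept as it is, so that a solution
    already built can be extended. *)
Lemma solat_glue q l r s1 s2 : matched q -> l < q < r ->
  (forall t, l < t < q -> solat s1 t) -> (forall t, q < t < r -> solat s2 t) ->
  exists s p, [/\ stable S p, forall t, l < t < r -> solat s t,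
    forall t, t < q -> s t = s1 t & forall t, q < t -> s t = (p * s2 t)%g].
Proof.
move=> [dr [dl [pi [piS yr yl ypi]]]] /andP[lq qr] sol1 sol2.
have [pr prS Xr] : exists2 p, stable S p & forall i, i \in S ->
    osd (fun h => y (s2 (q + h) i) (q + h)) (y (p i) q) (dr (p i)).
  have rq : 0 < r - q by rewrite subr_gt0.
  have h1 h : 0 < h < r - q -> q < q + h < r.
    by move=> /andP[? ?]; apply/andP; split; lra.
  apply: (selections_osd (s := fun h => s2 (q + h)) rq _ yr) => //.
  - move=> i iS h /h1 /sol2 hs.
    apply: (@continuous_comp _ _ _ (fun h => q + h) (fun u => y (s2 u i) u)).
      by apply: cvgD; [exact: cvg_cst|exact: cvg_id].
    exact: solat_continuous.
  - by move=> h /h1 /sol2[].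
have [pl plS Xl] : exists2 p, stable S p & forall i, i \in S ->
    osd (fun h => y (s1 (q - h) i) (q - h)) (y (p i) q) (dl (p i)).
  have rq : 0 < q - l by rewrite subr_gt0.
  have h1 h : 0 < h < q - l -> l < q - h < q.
    by move=> /andP[? ?]; apply/andP; split; lra.
  apply: (selections_osd (s := fun h => s1 (q - h)) rq _ yl) => //.
  - move=> i iS h /h1 /sol1 hs.
    apply: (@continuous_comp _ _ _ (fun h => q - h) (fun u => y (s1 u i) u)).
      by apply: cvgB; [exact: cvg_cst|exact: cvg_id].
    exact: solat_continuous.
  - by move=> h /h1 /sol1[].
(* Then [pr (p i) = pi (pl i)]: the curve arriving along branch [pl i] continues with the right-hand
   curve that leaves along the matched branch. *)
pose p := (pl * pi * pr^-1)%g.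
have pS : stable S p by apply: stableM; [exact: stableM|exact: stableV].
pose s t := if t < q then s1 t else if t == q then pl else (p * s2 t)%g.
have sl t : t < q -> s t = s1 t by rewrite /s => ->.
have sr t : q < t -> s t = (p * s2 t)%g.
  by move=> qt; rewrite /s lt_gtF// gt_eqF.
exists s, p; split => // t /andP[lt tr]; case: (ltgtP t q) => tq.
- apply: solat_near (sol1 t _); last by rewrite lt tq.
  by near=> u; rewrite sl//; near: u; exact: lt_nbhsl.
- apply: solat_near (solatM pS (sol2 t _)); last by rewrite tq tr.
  by near=> u; rewrite sr//; near: u; exact: lt_nbhsr.
rewrite tq; have sq : s q = pl by rewrite /s ltxx eqxx.
split; first by rewrite sq.
move=> i iS; apply/derivableP_osd; exists (- dl (pl i)); rewrite sq opprK; split.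
  have pliS : pl i \in S by rewrite plS.
  have [yq <-] := ypi _ pliS; rewrite -yq.
  have <- : pr (p i) = pi (pl i) by rewrite !permM permKV.
  apply: osd_near (Xr (p i) _); last by rewrite pS.
  near=> h; rewrite sr ?permM// ltrDl; near: h; exact: nbhs_right_gt.
apply: osd_near (Xl i iS).
near=> h; rewrite sl ?permM// ltrBlDr ltrDl; near: h; exact: nbhs_right_gt.
Unshelve. all: by end_near. Qed.

End Gluing.

(** * Boundary points of a solved interval *)

Section LocalToGlobal.
Variables (R : realType) (T : finType) (S : {set T}) (y : T -> R -> R).
Implicit Types (s : R -> {perm T}) (p q t u : R) (U V : set R).

Definition btw p t u := (p <= u <= t) || (t <= u <= p).

(** The connected component of [p] in [U], described by segments; it is empty when [p] lies outside
    [U]. *)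
Definition component U p : set R := [set t | forall u, btw p t u -> U u].

(** The solution omits the centre [q], which is filled in by gluing when the branches are matched
    there. *)
Definition solvable_around U q := exists2 e, 0 < e &
  (forall t, `|t - q| < e -> U t) /\
  exists s, forall t, 0 < `|t - q| < e -> solat S y s t.

Lemma solvable_ball U q : matched S y q -> solvable_around U q ->
  exists2 e, 0 < e & (forall t, `|t - q| < e -> U t) /\
  exists s, forall t, `|t - q| < e -> solat S y s t.
Proof.
move=> mq [e e0 [eU [s sP]]]; exists e => //; split => //.
have [|||s' [p [_ sol' _ _]]] := @solat_glue R T S y q (q - e) (q + e) s s mq.
- by apply/andP; split; lra.
- move=> t /andP[t1 t2]; apply: sP; rewrite normr_gt0 subr_eq0 lt_eqF//=.
  by rewrite ltr_norml; apply/andP; split; lra.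
- move=> t /andP[t1 t2]; apply: sP; rewrite normr_gt0 subr_eq0 gt_eqF//=.
  by rewrite ltr_norml; apply/andP; split; lra.
by exists s' => t; rewrite ltr_distl => tq; exact: sol'.
Qed.

(** The given solution [s] on the side of [p] is glued at [q] to the local one on the far side, in
    such a way that [s] itself is unchanged on [V]. *)
Lemma solve_boundary U V q s p :
  (forall t, V t -> solat S y s t) ->
  matched S y q -> solvable_around U q -> p != q ->
  (forall u, btw p q u -> u != q -> V u) ->
  (forall u, btw p u q -> ~ V u) ->
  exists2 e, 0 < e & (forall t, `|t - q| < e -> U t) /\
  exists s', forall t, `|t - q| < e -> solat S y s' t /\ (V t -> s' t = s t).
Proof.
move=> sV mq [e e0 [eU [s2 s2P]]] pq Vpq nV.
(* The bound by the distance to [p] ensures that the points near [q] on the side of [p] lie between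
   [p] and [q], hence in [V]. *)
pose r := Num.min e `|p - q|.
have re : r <= e by rewrite ge_min lexx.
have rpq : r <= `|p - q| by rewrite ge_min lexx orbT.
have r0 : 0 < r by rewrite lt_min e0 normr_gt0 subr_eq0.
exists r => //; split; first by move=> t tr; apply: eU; exact: lt_le_trans re.
have s2P' t : t != q -> q - r < t < q + r -> solat S y s2 t.
  move=> tq tr; apply: s2P; rewrite normr_gt0 subr_eq0 tq.
  by rewrite (lt_le_trans _ re)// ltr_distl.
have qr : q - r < q < q + r by apply/andP; split; lra.
have qNr t : `|t - q| < r -> q - r < t < q + r by rewrite ltr_distl.
case: (ltgtP p q) pq rpq => // pq _ rpq.
- rewrite ltr0_norm ?subr_lt0// in rpq.
  have [||s' [p' [_ sol' sl' _]]] := @solat_glue R T S y q (q - r) (q + r) s s2 mq qr.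
  + move=> t /andP[t1 t2]; apply/sV/Vpq; last by rewrite lt_eqF.
    by rewrite /btw; apply/orP; left; apply/andP; split; lra.
  + by move=> t /andP[t1 t2]; apply: s2P'; [rewrite gt_eqF|apply/andP; split; lra].
  exists s' => t /qNr tr; split=> [|Vt]; first exact: sol'.
  apply: sl'; rewrite ltNge; apply/negP => qt; apply: (nV t) => //.
  by rewrite /btw (ltW pq) qt.
- rewrite gtr0_norm ?subr_gt0// in rpq.
  have [||s' [p' [pS sol' _ sr']]] := @solat_glue R T S y q (q - r) (q + r) s2 s mq qr.
  + by move=> t /andP[t1 t2]; apply: s2P'; [rewrite lt_eqF|apply/andP; split; lra].
  + move=> t /andP[t1 t2]; apply/sV/Vpq; last by rewrite gt_eqF.
    by rewrite /btw; apply/orP; right; apply/andP; split; lra.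
  (* Gluing preserved the left solution, but here [s] is on the right; the factor [p'^-1] moves the
     renumbering to the other side. *)
  exists (fun t => p'^-1 * s' t)%g => t /qNr tr; split=> [|Vt].
    by apply: solatM; [exact: stableV|exact: sol'].
  rewrite sr' ?mulKg// ltNge; apply/negP => qt; apply: (nV t) => //.
  by rewrite /btw (ltW pq) qt orbT.
Qed.

(** The point [q] is the supremum or infimum of the part of [V] on the side of [t]; it lies outside
    [V] because [V] is open. *)
Lemma boundary_point V p t : open V -> V p ->
  (forall w, V w -> forall u, btw p w u -> V u) -> ~ V t ->
  exists q, [/\ btw p t q, q != p, forall u, btw p q u -> u != q -> V u &
    forall u, btw p u q -> ~ V u].
Proof.
move=> oV Vp iV nVt.
have pt : p != t by apply/eqP => pt; apply: nVt; rewrite -pt.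
have nbV w : V w -> exists2 e, 0 < e & forall u, `|u - w| < e -> V u.
  move=> Vw; have /nbhs_ballP[e /= e0 eV] : nbhs w V by exact: open_nbhs_nbhs.
  by exists e => // u uw; apply: eV; rewrite /ball/= distrC.
case: (ltgtP p t) pt => // pt _.
- have hs : has_sup [set w | V w /\ p <= w].
    split; first by exists p => /=; split.
    exists t => w [Vw pw]; rewrite leNgt; apply/negP => tw; apply: nVt.
    by apply: (iV w) => //; rewrite /btw (ltW pt) (ltW tw).
  set q := sup [set w | V w /\ p <= w] in hs *.
  have qub w : V w -> p <= w -> w <= q by move=> Vw pw; apply: sup_upper_bound.
  have pq : p <= q by exact: qub.
  have qt : q <= t.
    apply: ge_sup; first by exists p.
    move=> w [Vw pw]; rewrite leNgt; apply/negP => tw; apply: nVt.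
    by apply: (iV w) => //; rewrite /btw (ltW pt) (ltW tw).
  have nVq : ~ V q.
    move=> /nbV[e e0 eV]; have : V (q + e / 2).
      by apply: eV; rewrite addrC addKr gtr0_norm; lra.
    by move=> /qub; lra.
  have qp : q != p by apply/eqP => qp; apply: nVq; rewrite qp.
  exists q; split => //; first by rewrite /btw pq qt.
    move=> u upq uq; have {upq} /andP[pu uq'] : p <= u <= q.
      by case/orP: upq => // /andP[? ?]; apply/andP; split; lra.
    have {}uq : u < q by rewrite lt_neqAle uq.
    have [w [Vw pw] uw] := sup_gt hs.1 uq.
    by apply: (iV w) => //; rewrite /btw pu (ltW uw).
  move=> u puq Vu; apply: nVq; exact: (iV u).
- have hs : has_inf [set w | V w /\ w <= p].
    split; first by exists p => /=; split.
    exists t => w [Vw pw]; rewrite leNgt; apply/negP => tw; apply: nVt.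
    by apply: (iV w) => //; rewrite /btw (ltW pt) (ltW tw) orbT.
  set q := inf [set w | V w /\ w <= p] in hs *.
  have qub w : V w -> w <= p -> q <= w by move=> Vw pw; apply: (ge_inf hs.2).
  have pq : q <= p by exact: qub.
  have qt : t <= q.
    apply: lb_le_inf; first by exists p.
    move=> w [Vw pw]; rewrite leNgt; apply/negP => tw; apply: nVt.
    by apply: (iV w) => //; rewrite /btw (ltW pt) (ltW tw) orbT.
  have nVq : ~ V q.
    move=> /nbV[e e0 eV]; have : V (q - e / 2).
      by apply: eV; rewrite addrC addKr normrN gtr0_norm; lra.
    by move=> /qub; lra.
  have qp : q != p by apply/eqP => qp; apply: nVq; rewrite qp.
  exists q; split => //; first by rewrite /btw pq qt orbT.
    move=> u upq uq; have {upq} /andP[pu uq'] : q <= u <= p.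
      by case/orP: upq => // /andP[? ?]; apply/andP; split; lra.
    have {}uq : q < u by rewrite lt_neqAle eq_sym uq.
    have [w [Vw pw] uw] := inf_lt hs.1 uq.
    by apply: (iV w) => //; rewrite /btw uq' (ltW uw) orbT.
  move=> u puq Vu; apply: nVq; exact: (iV u).
Qed.

End LocalToGlobal.

(** * From local to global solutions *)

Section Components.
Variables (R : realType) (T : finType) (S : {set T}) (y : T -> R -> R).
Variable U : set R.
Hypothesis U_matched : forall q, U q -> matched S y q.
Hypothesis U_solvable : forall q, U q -> solvable_around S y U q.

(** The third clause makes [V] an interval around [p]. These pairs are the objects to which Zorn's
    lemma is applied. *)
Definition partial_solution (p : R) (V : set R) (s : R -> {perm T}) :=
  [/\ open V, V p, forall w, V w -> forall u, btw p w u -> V u &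
      forall t, V t -> solat S y s t].

Lemma partial_solution_ball p : U p -> exists V s, partial_solution p V s.
Proof.
move=> Up; have [e e0 [_ [s sP]]] := solvable_ball (U_matched Up) (U_solvable Up).
exists (ball p e), s; split.
- exact: ball_open.
- exact: ballxx.
- move=> w /=; rewrite /ball/= => pw u upw.
  by move: pw; rewrite !ltr_distl; case/orP: upw => /andP[? ?] /andP[? ?];
    apply/andP; split; lra.
- by move=> t; rewrite /ball/= distrC; exact: sP.
Qed.

Lemma partial_solution_extend p V s t : partial_solution p V s ->
  component U p t -> ~ V t -> exists V' s',
  [/\ partial_solution p V' s', V `<=` V', ~ V' `<=` V &
      forall u, V u -> s' u = s u].
Proof.
move=> [oV Vp iV sV] Upt nVt.
have [q [ptq qp Vpq nV]] := boundary_point oV Vp iV nVt.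
have Uq : U q by exact: Upt.
have pq : p != q by rewrite eq_sym.
have [e e0 [eU [s1 s1P]]] :=
  solve_boundary sV (U_matched Uq) (U_solvable Uq) pq Vpq nV.
(* The two solutions agree where [V] meets the ball, so near each point the new one coincides with
   one of them. *)
exists (V `|` ball q e), (fun u => if `[< V u >] then s u else s1 u); split.
- split; [exact: openU oV (ball_open _ _)|by left| |].
  + move=> w [Vw u upw|]; first by left; exact: (iV w).
    rewrite /ball/= => qw u upw.
    have [uq|nuq] := ltP `|q - u| e; first by right.
    (* A point outside the ball, on the way from [p] to a point of the ball, lies between [p] and
       [q]. *)
    left; apply: Vpq; last first.
      by apply/eqP => uq; move: nuq; rewrite uq subrr normr0 leNgt e0.
    move: qw nuq; rewrite ltr_distl leNgt ltr_distl negb_and -!leNgt /btw.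
    case/orP: upw => /andP[? ?] /andP[? ?] /orP[?|?].
    * by apply/orP; left; apply/andP; split; lra.
    * by apply/orP; left; apply/andP; split; lra.
    * by apply/orP; right; apply/andP; split; lra.
    * by apply/orP; right; apply/andP; split; lra.
  + move=> u [Vu|].
      apply: solat_near (sV u Vu).
      have : nbhs u V by exact: open_nbhs_nbhs.
      by apply: filterS => w Vw; case: asboolP.
    move=> qu; have uq : `|u - q| < e by rewrite distrC.
    apply: solat_near (s1P u uq).1.
    have : nbhs u (ball q e) by apply: open_nbhs_nbhs; split; [exact: ball_open|].
    apply: filterS => w qw; have wq : `|w - q| < e by rewrite distrC.
    by case: asboolP => // Vw; rewrite (s1P w wq).2.
- by move=> u Vu; left.
- move=> sub; apply: (nV q); last by apply: sub; right; exact: ballxx.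
  by move: ptq; rewrite /btw; case/orP => /andP[h1 h2]; rewrite ?h1 ?h2 lexx ?orbT.
- by move=> u Vu; case: asboolP.
Qed.

(** By Zorn's lemma there is a partial solution that no other properly extends; it covers the
    component, since otherwise it could be extended past a boundary point. *)
Lemma solve_component p : U p -> exists s, forall t, component U p t -> solat S y s t.
Proof.
move=> Up.
pose X := {x : set R * (R -> {perm T}) | partial_solution p x.1 x.2}.
pose le (a b : X) := `[< (sval a).1 `<=` (sval b).1 /\
  forall u, (sval a).1 u -> (sval b).2 u = (sval a).2 u >].
have [V0 [s0 V0s0]] := partial_solution_ball Up.
have [||A Atot|[[V s] Vs] /= maxV] := @ZL_preorder X (exist _ (V0, s0) V0s0) le.
- by move=> a; apply/asboolP; split.
- move=> b a c /asboolP[ab abs] /asboolP[bc bcs]; apply/asboolP; split.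
    exact: subset_trans bc.
  by move=> u au; rewrite bcs ?abs//; exact: ab.
- have [[a0 Aa0]|A0] := pselect (A !=set0); last first.
    exists (exist _ (V0, s0) V0s0) => a Aa; exfalso; apply: A0; by exists a.
  pose W : set R := [set u | exists2 a, A a & (sval a).1 u].
  have choose u : exists a, W u -> A a /\ (sval a).1 u.
    have [[a Aa au]|nWu] := pselect (W u); first by exists a.
    by exists a0 => /nWu.
  have {choose} [f fP] := choice choose.
  (* All members of the chain whose domain contains [u] give the same value at [u], the chain being
     totally ordered by extension. *)
  pose s u := (sval (f u)).2 u.
  have sE a u : A a -> (sval a).1 u -> s u = (sval a).2 u.
    move=> Aa au; have [Af fu] : A (f u) /\ (sval (f u)).1 u by apply: fP; exists a.
    rewrite /s; have [/asboolP[_]|/asboolP[_]] := Atot _ _ Aa Af; first exact.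
    by move=> ->.
  have Ws : partial_solution p W s.
    split.
    + have -> : W = \bigcup_(a in A) (sval a).1 by [].
      by apply: bigcup_open => a Aa; have [] := svalP a.
    + by exists a0 => //; have [] := svalP a0.
    + move=> w [a Aa aw] u upw; exists a => //.
      by have [_ _ ia _] := svalP a; exact: (ia w).
    + move=> t [a Aa at']; have [oa _ _ sa] := svalP a.
      apply: solat_near (sa t at').
      have : nbhs t (sval a).1 by exact: open_nbhs_nbhs.
      by apply: filterS => u au; rewrite (sE a).
  exists (exist _ (W, s) Ws) => a Aa; apply/asboolP; split => /=.
    by move=> u au; exists a.
  by move=> u au; exact: sE.
have [oV Vp iV sV] := Vs.
exists s => t Upt; apply: sV; apply: contrapT => nVt.
have [V' [s' [V's' VV' V'V ss']]] := partial_solution_extend Vs Upt nVt.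
have := maxV (exist _ (V', s') V's').
have -> : le (exist _ (V, s) Vs) (exist _ (V', s') V's') by apply/asboolP.
by move=> /(_ isT) /asboolP[].
Qed.

Lemma btw_trans (p t w u : R) : btw p w u -> btw p t u \/ btw t w u.
Proof.
rewrite /btw => /orP[|] /andP[h1 h2].
- case: (leP u t) => ut; [left|right]; apply/orP.
    by left; rewrite h1.
  by left; rewrite h2 ltW.
- case: (leP u t) => ut; [right|left]; apply/orP.
    by right; rewrite h1.
  by right; rewrite h2 ltW.
Qed.

Lemma component_sym p t : component U p t -> component U t p.
Proof. by move=> pt u; rewrite /btw orbC => /pt. Qed.

Lemma component_trans p t w : component U p t -> component U t w -> component U p w.
Proof. by move=> pt tw u /(@btw_trans _ t)[/pt|/tw]. Qed.

Lemma component_eq p t : component U p t -> component U p = component U t.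
Proof.
move=> pt; apply/seteqP; split => u; first exact/component_trans/component_sym.
exact: component_trans.
Qed.

Lemma local_to_global : exists s, forall t, U t -> solat S y s t.
Proof.
have ex p : exists s, U p -> forall t, component U p t -> solat S y s t.
  have [Up|nUp] := pselect (U p); last by exists (fun=> 1%g) => /nUp.
  by have [s sP] := solve_component Up; exists s.
have [F FP] := choice ex.
have refl p : U p -> component U p p.
  by move=> Up u; rewrite /btw orbb => /andP[pu up]; have -> : u = p by lra.
(* [xget] depends only on the component as a set, so all points of a component use the same
   solution. The default [0] arises only outside [U]. *)
pose rep t := xget 0 (component U t).
have repP t : U t -> component U t (rep t).
  by move=> Ut; apply: xgetPex; exists t; exact: refl.
have repU t : U t -> U (rep t).
  move=> Ut; apply: (repP t Ut); rewrite /btw lexx; case: (leP t (rep t)) => //.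
  by move=> /ltW ->; rewrite orbT.
exists (fun t => F (rep t) t) => t Ut.
apply: (@solat_near _ _ _ _ (F (rep t))); last first.
  by apply: FP; [exact: repU|exact/component_sym/repP].
have [e e0 [eU _]] := U_solvable Ut.
have : nbhs t (ball t e) by exact: nbhsx_ballx.
(* A ball inside [U] lies in a single component, so the representative is locally constant. *)
apply: filterS => u tu; congr (F _ u); congr (xget 0 _).
apply: component_eq => w tw; apply: eU; move: tu tw; rewrite /ball/= /btw.
rewrite !ltr_distl => /andP[? ?] /orP[|] /andP[? ?]; apply/andP; split; lra.
Qed.

End Components.

(** * Induction on the number of branches *)

Lemma near_punctured (R : realType) (q : R) (P : R -> Prop) :
  (\forall h \near 0^'+, P (q + h)) -> (\forall h \near 0^'+, P (q - h)) ->
  exists2 e, 0 < e & forall t, 0 < `|t - q| < e -> P t.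
Proof.
move=> [a a0 aP] [b b0 bP]; exists (Num.min a b); first by rewrite lt_min a0.
move=> t; rewrite normr_gt0 subr_eq0 lt_min => /and3P[tq ta tb].
case: (ltgtP t q) tq => // tq _.
- have -> : t = q - (q - t) by ring.
  by apply: bP; rewrite /ball_ /= ?subr_gt0// sub0r opprB.
- have -> : t = q + (t - q) by ring.
  by apply: aP; rewrite /ball_ /= ?subr_gt0// sub0r normrN.
Qed.

Section MatchedSolution.
Variables (R : realType) (T : finType) (y : T -> R -> R).
Implicit Types (S A B : {set T}) (s : R -> {perm T}) (q t u : R) (U V W : set R).

Lemma stable_of_subset A (p : {perm T}) : (forall i, i \in A -> p i \in A) ->
  stable A p.
Proof.
move=> pA i.
have sub : p @: A \subset A by apply/fintype.subsetP => _ /imsetP[j jA ->]; exact: pA.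
have /eqP pAA : p @: A == A by rewrite eqEcard sub (card_imset _ (@perm_inj _ p)) leqnn.
by rewrite -[in LHS]pAA (mem_imset _ _ (@perm_inj _ p)).
Qed.

(** The matching permutation preserves the values at [t], so it cannot leave a subfamily whose
    values are separated from the others. *)
Lemma matched_subset S A t : matched S y t -> A \subset S ->
  (forall i j, i \in A -> j \in S :\: A -> y i t != y j t) -> matched A y t.
Proof.
move=> [dr [dl [p [pS yr yl yp]]]] /fintype.subsetP AS sep; exists dr, dl, p; split.
- apply: stable_of_subset => i iA; apply: contraT => piA.
  have := sep i (p i) iA; rewrite (yp i (AS i iA)).1 eqxx; apply.
  by rewrite inE piA pS AS.
- by move=> i /AS; exact: yr.
- by move=> i /AS; exact: yl.
- by move=> i /AS; exact: yp.
Qed.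

Lemma perm_union A B (pA pB : {perm T}) : (forall i, i \in B -> i \notin A) ->
  stable A pA -> stable B pB -> exists p : {perm T}, [/\ stable (A :|: B) p,
  forall i, i \in A -> p i = pA i & forall i, i \in B -> p i = pB i].
Proof.
move=> nAB sA sB.
pose f i := if i \in A then pA i else if i \in B then pB i else i.
have fI : injective f.
  move=> i j; rewrite /f.
  case: (boolP (i \in A)) => iA; case: (boolP (j \in A)) => jA; first exact: perm_inj.
  - move=> e; have : pA i \in A by rewrite sA.
    move: e; case: ifPn => jB ->; last by rewrite (negPf jA).
    by have := nAB (pB j); rewrite sB => /(_ jB) /negPf ->.
  - move=> e; have : pA j \in A by rewrite sA.
    move: e; case: ifPn => iB <-; last by rewrite (negPf iA).
    by have := nAB (pB i); rewrite sB => /(_ iB) /negPf ->.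
  - case: (boolP (i \in B)) => iB; case: (boolP (j \in B)) => jB //; first exact: perm_inj.
    + by move=> e; move: jB; rewrite -e sB iB.
    + by move=> e; move: iB; rewrite e sB jB.
exists (perm fI); split.
- move=> i; rewrite permE /f !inE; case: ifPn => iA; first by rewrite sA iA.
  case: ifPn => iB /=; first by rewrite sB iB orbT.
  by rewrite (negPf iA) (negPf iB).
- by move=> i iA; rewrite permE /f iA.
- by move=> i iB; rewrite permE /f iB (negPf (nAB _ iB)).
Qed.

Lemma solve_union A B V sA sB : open V -> (forall i, i \in B -> i \notin A) ->
  (forall t, V t -> solat A y sA t) -> (forall t, V t -> solat B y sB t) ->
  exists s, forall t, V t -> solat (A :|: B) y s t.
Proof.
move=> oV AB solA solB.
have ex t : exists p : {perm T}, V t -> [/\ stable (A :|: B) p,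
  forall i, i \in A -> p i = sA t i & forall i, i \in B -> p i = sB t i].
  have [Vt|nVt] := pselect (V t); last by exists 1%g.
  by have [p pP] := perm_union AB (solA t Vt).1 (solB t Vt).1; exists p.
have [s sP] := choice ex; exists s => t Vt; split; first by have [] := sP t Vt.
have nV : nbhs t V by exact: open_nbhs_nbhs.
move=> i; rewrite inE => /orP[iA|iB].
- apply: near_eq_derivable ((solA t Vt).2 i iA).
  by apply: filterS nV => u Vu; have [_ sE _] := sP u Vu; rewrite sE.
- apply: near_eq_derivable ((solB t Vt).2 i iB).
  by apply: filterS nV => u Vu; have [_ _ sE] := sP u Vu; rewrite sE.
Qed.

Lemma matched_continuous S q i : matched S y q -> i \in S ->
  forall e, 0 < e -> exists2 r, 0 < r & forall t, `|t - q| < r -> `|y i t - y i q| < e.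
Proof.
move=> [dr [dl [p [pS yr yl yp]]]] iS e e0.
have [r r0 rP] := near_punctured (P := fun t => `|y i t - y i q| < e)
  (osd_cvg (yr i iS) e0) (osd_cvg (yl i iS) e0).
exists r => // t tr; have [->|tq] := eqVneq t q; first by rewrite subrr normr0.
by apply: rP; rewrite normr_gt0 subr_eq0 tq.
Qed.

Lemma matched_sep S q i j : matched S y q -> i \in S -> j \in S -> y i q != y j q ->
  exists2 r, 0 < r & forall t, `|t - q| < r -> y i t != y j t.
Proof.
move=> mq iS jS yij; pose e := `|y i q - y j q| / 2.
have e0 : 0 < e by rewrite divr_gt0// normr_gt0 subr_eq0.
have [a a0 aP] := matched_continuous mq iS e0.
have [b b0 bP] := matched_continuous mq jS e0.
exists (Num.min a b); first by rewrite lt_min a0.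
move=> t; rewrite lt_min => /andP[/aP ta /bP tb]; apply/eqP => yt.
suff : `|y i q - y j q| < `|y i q - y j q| by rewrite ltxx.
have -> : y i q - y j q = (y j t - y j q) - (y i t - y i q) by rewrite yt; ring.
apply: le_lt_trans (ler_normB _ _) _; rewrite [ltRHS]splitr.
have -> : y j t - y j q - (y i t - y i q) = y i q - y j q by rewrite yt; ring.
exact: ltrD.
Qed.

Definition coincide S t := forall i j, i \in S -> j \in S -> y i t = y j t.

(** At these points every relabelling is differentiable, so they may be removed from the set on
    which the labelling has to be constructed. *)
Definition tangent S t := coincide S t /\ exists d, forall i, i \in S ->
  osd (fun h => y i (t + h)) (y i t) d /\ osd (fun h => y i (t - h)) (y i t) (- d).

(** The branches with the value of [i0] at [q] and the remaining ones form two proper subfamilies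
    that stay apart near [q]. The induction hypothesis solves each, and the two solutions are
    combined. *)
Lemma solvable_off_coincide S W q :
  (forall A, (#|A| < #|S|)%N -> forall V, open V ->
    (forall t, V t -> matched A y t) -> exists s, forall t, V t -> solat A y s t) ->
  open W -> (forall t, W t -> matched S y t) ->
  W q -> ~ coincide S q -> solvable_around S y (W `&` ~` coincide S) q.
Proof.
move=> IH oW mW Wq nc; have mq := mW q Wq.
have [i0 [j0 [i0S j0S yij]]] : exists i j, [/\ i \in S, j \in S & y i q != y j q].
  apply: contrapT => nex; apply: nc => i j iS jS; apply/eqP; apply: contrapT => yij.
  by apply: nex; exists i, j; split => //; apply/negP.
pose A : {set T} := [set i in S | y i q == y i0 q]%SET.
have AS : A \subset S by apply/fintype.subsetP => i; rewrite inE => /andP[].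
have i0A : i0 \in A by rewrite inE i0S eqxx.
have j0A : j0 \in S :\: A by rewrite !inE j0S /= andbT eq_sym yij.
have [e e0 eP] : exists2 e, 0 < e & forall t, `|t - q| < e ->
    W t /\ forall i j, i \in A -> j \in S :\: A -> y i t != y j t.
  have : \forall e \near (0 : R)^'+, forall t, `|t - q| < e ->
    W t /\ forall ij : T * T, ij.1 \in A -> ij.2 \in S :\: A -> y ij.1 t != y ij.2 t.
    have nW : \forall e \near (0 : R)^'+, forall t, `|t - q| < e -> W t.
      have /nbhs_ballP[e /= e0 eW] : nbhs q W by exact: open_nbhs_nbhs.
      apply: filterS (nbhs_right_lt e0) => r re t tr; apply: eW.
      by rewrite /ball/= distrC; exact: lt_trans re.
    have nij : \forall e \near (0 : R)^'+, forall ij : T * T, forall t, `|t - q| < e ->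
        ij.1 \in A -> ij.2 \in S :\: A -> y ij.1 t != y ij.2 t.
      apply: filter_forall => -[i j] /=.
      have [iA|iA] := boolP (i \in A); last by near=> e.
      have [jA|jA] := boolP (j \in S :\: A); last by near=> e.
      have iS : i \in S by move/fintype.subsetP: AS; apply.
      have jS : j \in S by move: jA; rewrite inE => /andP[].
      have yijq : y i q != y j q.
        move: iA jA; rewrite !inE => /andP[_ /eqP ->]; rewrite jS/= andbT.
        by rewrite eq_sym.
      have [r r0 rP] := matched_sep mq iS jS yijq.
      apply: filterS (nbhs_right_lt r0) => e er t te _ _; apply: rP.
      exact: lt_trans er.
    apply: filterS2 nW nij => e h1 h2 t te; split; first exact: h1.
    by move=> ij; exact: h2.
  move=> nall; have [e [e0 eP]] :=
    @filter_ex R _ (at_right_proper_filter (0 : R)) _ (filterI (nbhs_right_gt 0) nall).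
  exists e => // t /eP[Wt tP]; split => // i j iA jA; exact: (tP (i, j)).
have bE t : ball q e t -> `|t - q| < e by rewrite /ball/= distrC.
have Aproper : A \proper S.
  by apply/properP; split=> //; exists j0 => //; move: j0A; rewrite inE => /andP[].
have SAE : A :|: (S :\: A) = S.
  apply/setP => i; rewrite !inE.
  by case: (i \in S); rewrite /= ?andbT ?andbF ?orbN.
have [sA solA] : exists s, forall t, ball q e t -> solat A y s t.
  apply: IH; [exact: proper_card|exact: ball_open|] => t /bE /eP[Wt tP].
  exact: (matched_subset (mW t Wt)).
have [sB solB] : exists s, forall t, ball q e t -> solat (S :\: A) y s t.
  apply: IH; [|exact: ball_open|] => [|t /bE /eP[Wt tP]].
    apply: proper_card; apply/properP; split; first exact: subsetDl.
    by exists i0 => //; rewrite inE i0A.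
  apply: (matched_subset (mW t Wt)); first exact: subsetDl.
  move=> i j iB jB; rewrite eq_sym; apply: tP => //.
  by move: jB; rewrite !inE; case: (j \in S) => //=; rewrite ?andbT ?andbF ?negbK.
have disj i : i \in S :\: A -> i \notin A by rewrite inE => /andP[].
have [s sP] := solve_union (ball_open _ _) disj solA solB.
rewrite SAE in sP.
exists e => //; split.
  move=> t /eP[Wt tP]; split => // tc; have := tP i0 j0 i0A j0A.
  by rewrite (tc i0 j0)// eqxx.
by exists s => t /andP[_ te]; apply: sP; rewrite /ball/= distrC.
Unshelve. all: by end_near. Qed.

(** Two right slopes differ, since otherwise the matching would make all left slopes equal as well
    and [q] would be a tangent point. The matching carries the difference to the left, and branches
    of distinct slopes separate. *)
Lemma coincide_isolated S q : matched S y q -> coincide S q -> ~ tangent S q ->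
  exists2 e, 0 < e & forall t, 0 < `|t - q| < e -> ~ coincide S t.
Proof.
move=> [dr [dl [p [pS yr yl yp]]]] cq nt.
have [i [j [iS jS dij]]] : exists i j, [/\ i \in S, j \in S & dr i != dr j].
  apply: contrapT => nex; apply: nt; split => //.
  have drE i j : i \in S -> j \in S -> dr i = dr j.
    move=> iS jS; apply/eqP; apply: contrapT => dij; apply: nex.
    by exists i, j; split => //; apply/negP.
  have [S0|[i0 i0S]] := set_0Vmem S; first by exists 0 => i; rewrite S0 inE.
  exists (dr i0) => i iS; split; first by rewrite (drE i0 i)//; exact: yr.
  by rewrite (drE i0 (p i)) ?pS// (yp i iS).2 opprK; exact: yl.
apply: near_punctured.
  have := osd_neq0 (osdB (yr i iS) (yr j jS)).
  rewrite [X in _ || ~~ X]subr_eq0 dij orbT => /(_ isT); apply: filterS => h nz ch.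
  by move: nz; rewrite (ch i j)// subrr eqxx.
have piS : (p^-1)%g i \in S by rewrite stableV.
have pjS : (p^-1)%g j \in S by rewrite stableV.
have := osd_neq0 (osdB (yl _ piS) (yl _ pjS)).
have -> : dl ((p^-1)%g i) - dl ((p^-1)%g j) != 0.
  have := (yp _ piS).2; have := (yp _ pjS).2; rewrite !permKV => dj di.
  by move: dij; rewrite dj di subr_eq0; apply: contra => /eqP ->.
rewrite orbT => /(_ isT); apply: filterS => h nz ch.
by move: nz; rewrite (ch _ _ piS pjS) subrr eqxx.
Qed.

(** All branches share value and slope at [t], and their finitely many errors are small
    simultaneously, whichever branch [s] picks. *)
Lemma solat_tangent S W s t : open W -> W t -> (forall u, W u -> stable S (s u)) ->
  tangent S t -> solat S y s t.
Proof.
move=> oW Wt sS [ct [d td]]; split; first exact: sS.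
move=> i iS; apply/derivableP_osd; exists d.
have /nbhs_ballP[e /= e0 eW] : nbhs t W by exact: open_nbhs_nbhs.
have sti : s t i \in S by rewrite sS.
split => c c0.
  have : \forall h \near 0^'+, forall j, j \in S -> `|y j (t + h) - y j t - d * h| <= c * h.
    apply: filter_forall => j; have [jS|jS] := boolP (j \in S); last by near=> h.
    by apply: filterS ((td j jS).1 c c0).
  have h0 := @nbhs_right_gt R 0; have he := nbhs_right_lt e0.
  move: h0 he; apply: filter_app3; near=> h => h0 he hj.
  have sS' : s (t + h) i \in S.
    by rewrite sS//; apply: eW; rewrite /ball/= opprD addrA subrr sub0r normrN gtr0_norm.
  by rewrite (ct _ (s (t + h) i)) //; exact: hj.
have : \forall h \near 0^'+, forall j, j \in S -> `|y j (t - h) - y j t - - d * h| <= c * h.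
  apply: filter_forall => j; have [jS|jS] := boolP (j \in S); last by near=> h.
  by apply: filterS ((td j jS).2 c c0).
have h0 := @nbhs_right_gt R 0; have he := nbhs_right_lt e0.
move: h0 he; apply: filter_app3; near=> h => h0 he hj.
have sS' : s (t - h) i \in S.
  by rewrite sS//; apply: eW; rewrite /ball/= opprB addrC subrK gtr0_norm.
by rewrite (ct _ (s (t - h) i)) //; exact: hj.
Unshelve. all: by end_near. Qed.

Lemma solvable_aroundS S U V q : U `<=` V -> solvable_around S y U q ->
  solvable_around S y V q.
Proof.
by move=> UV [e e0 [eU es]]; exists e => //; split=> // t /eU /UV.
Qed.

(** By strong induction on the size of [S], the labelling is built in three stages: where the
    branches do not all coincide, then across the isolated coincidences with different slopes, then
    at the tangent points. *)
Lemma matched_solution S W : open W -> (forall t, W t -> matched S y t) ->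
  exists s, forall t, W t -> solat S y s t.
Proof.
move: {2}#|S|.+1 (ltnSn #|S|) => n; elim: n S W => // n IHn S W Sn oW mW.
have IH A : (#|A| < #|S|)%N -> forall V, open V ->
    (forall t, V t -> matched A y t) -> exists s, forall t, V t -> solat A y s t.
  by move=> AS V; apply: IHn; exact: leq_trans AS _.
have off q : (W `&` ~` coincide S) q -> solvable_around S y (W `&` ~` coincide S) q.
  by move=> [Wq nc]; exact: solvable_off_coincide.
have [|s1 sol1] := @local_to_global R T S y (W `&` ~` coincide S) _ off.
  by move=> q [/mW].
have sub : W `&` ~` coincide S `<=` W `&` ~` tangent S.
  by move=> t [Wt nc]; split => // -[].
have off' q : (W `&` ~` tangent S) q -> solvable_around S y (W `&` ~` tangent S) q.
  move=> [Wq nt]; have [cq|nc] := pselect (coincide S q); last first.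
    by apply: solvable_aroundS (off q _).
  have [a a0 aP] := coincide_isolated (mW q Wq) cq nt.
  have /nbhs_ballP[b /= b0 bW] : nbhs q W by exact: open_nbhs_nbhs.
  have eP t : 0 < `|t - q| < Num.min a b -> (W `&` ~` coincide S) t.
    rewrite lt_min => /and3P[t0 ta tb]; split; last by apply: aP; rewrite t0.
    by apply: bW; rewrite /ball/= distrC.
  exists (Num.min a b); first by rewrite lt_min a0.
  split; last by exists s1 => t /eP; exact: sol1.
  move=> t te; have [->//|tq] := eqVneq t q.
  by apply: sub; apply: eP; rewrite normr_gt0 subr_eq0 tq.
have [|s2 sol2] := @local_to_global R T S y (W `&` ~` tangent S) _ off'.
  by move=> q [/mW].
have nU t : W t -> ~ tangent S t -> \forall u \near t, (W `&` ~` tangent S) u.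
  move=> Wt nt; have [e e0 [eU _]] := off' t (conj Wt nt).
  have : nbhs t (ball t e) by exact: nbhsx_ballx.
  by apply: filterS => u; rewrite /ball/= distrC => /eU.
(* At tangent points any stable value would do; the identity is taken. *)
pose s t := if `[< (W `&` ~` tangent S) t >] then s2 t else 1%g.
exists s => t Wt; have [tt|nt] := pselect (tangent S t).
  apply: solat_tangent oW Wt _ tt => u Wu; rewrite /s; case: asboolP => [Uu|_].
    exact: (sol2 u Uu).1.
  exact: stable1.
apply: solat_near (sol2 t (conj Wt nt)).
by apply: filterS (nU t Wt nt) => u Uu; rewrite /s; case: asboolP.
Qed.

End MatchedSolution.

(** * Sorted roots of real-rooted polynomials *)

Section Roots.
Variable R : realType.

Lemma poly_eq_of_horner (p q : {poly R}) : (forall z, p.[z] = q.[z]) -> p = q.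
Proof.
move=> pq; apply/eqP; rewrite -subr_eq0; apply: contraT => nz.
pose s := [seq i%:R : R | i <- iota 0 (size (p - q)%R)].
have : (size s < size (p - q)%R)%N.
  apply: max_poly_roots => //.
    by apply/allP => z _; rewrite rootE hornerD hornerN pq subrr.
  by rewrite map_inj_uniq ?iota_uniq//; exact: mulrIn (oner_neq0 _).
by rewrite size_map size_iota ltnn.
Qed.

Lemma horner_prod_XsubC n (A : {set 'I_n}) (u : 'I_n -> R) z :
  (\prod_(i in A) ('X - (u i)%:P)).[z] = \prod_(i in A) (z - u i).
Proof. by rewrite horner_prod; apply: eq_bigr => i _; rewrite hornerXsubC. Qed.

Lemma perm_eq_roots n (A : {set 'I_n}) (u v : 'I_n -> R) :
  (forall z, \prod_(i in A) (z - u i) = \prod_(i in A) (z - v i)) ->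
  perm_eq [seq u i | i <- enum A] [seq v i | i <- enum A].
Proof.
move=> uv; apply: prod_XsubC_eq; rewrite !big_map !big_enum /=.
by apply: poly_eq_of_horner => z; rewrite !horner_prod_XsubC.
Qed.

(** [enum A] lists [A] in increasing order, and a sorted sequence is determined by its multiset of
    values. *)
Lemma sorted_roots_unique n (A : {set 'I_n}) (u v : 'I_n -> R) :
  {in A &, forall i j : 'I_n, (i <= j)%N -> u i <= u j} ->
  {in A &, forall i j : 'I_n, (i <= j)%N -> v i <= v j} ->
  (forall z, \prod_(i in A) (z - u i) = \prod_(i in A) (z - v i)) ->
  {in A, u =1 v}.
Proof.
move=> um vm /perm_eq_roots puv i iA.
have sA : sorted (fun i j : 'I_n => (i <= j)%N) (enum A).
  rewrite /enum_mem; apply: sorted_filter => [? ? ?|]; first exact: leq_trans.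
  rewrite -enumT -(@sorted_map _ _ val leq) val_enum_ord.
  exact: iota_sorted.
have smono (w : 'I_n -> R) : {in A &, forall i j : 'I_n, (i <= j)%N -> w i <= w j} ->
    sorted <=%R [seq w i | i <- enum A].
  move=> wm; rewrite sorted_map; apply: sub_in_sorted sA; last first.
    by apply/allP => j; rewrite mem_enum; exact: id.
  by move=> j k jA kA; exact: wm.
have /eq_in_map : [seq u i | i <- enum A] = [seq v i | i <- enum A].
  by apply: (sorted_eq le_trans le_anti) => //; exact: smono.
by apply; rewrite mem_enum.
Qed.

(** On the compact segment from [- C] to [C] every ultrafilter converges, so each root has a limit;
    order and product pass to the limits. *)
Lemma ultra_sorted_roots n (A : {set 'I_n}) (X : topologicalType) (G : set_system X)
    (u : 'I_n -> X -> R) (C : R) (g : R -> R) : UltraFilter G ->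
  (forall i, i \in A -> \forall x \near G, `|u i x| <= C) ->
  (forall i j : 'I_n, i \in A -> j \in A -> (i <= j)%N -> \forall x \near G, u i x <= u j x) ->
  (forall z, (fun x => \prod_(i in A) (z - u i x)) @ G --> g z) ->
  exists l : 'I_n -> R, [/\ {in A &, forall i j : 'I_n, (i <= j)%N -> l i <= l j},
    forall z, \prod_(i in A) (z - l i) = g z & forall i, i \in A -> u i @ G --> l i].
Proof.
move=> GU uC um ug; have GP : ProperFilter G by exact: ultra_proper.
have ex i : exists l : R, i \in A -> u i @ G --> l.
  have [iA|iA] := boolP (i \in A); last by exists 0.
  have [|l [_ lc]] := @segment_compact R (- C) C (u i @ G) _.
    by apply: filterS (uC i iA) => x /=; rewrite ler_norml in_itv.
  exists l => _ N lN.
  have [//|GnN] := in_ultra_setVsetC (u i @^-1` N) GU.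
  have GnN' : (u i @ G) (~` N) by [].
  by have [x []] := lc _ _ GnN' lN.
have [l lP] := choice ex; exists l; split => //.
- move=> i j iA jA ij; apply: ler_cvg_to (lP i iA) (lP j jA) _; exact: um.
- move=> z; apply: (cvg_unique _ _ (ug z)); first exact: norm_hausdorff.
  have h : continuous (fun x : R * R => x.1 * x.2) by move=> x; exact: mul_continuous.
  apply: (@cvg_big _ _ _ _ _ h) => i iA; apply: cvgB; first exact: cvg_cst.
  exact: lP.
Qed.

(* All limits along ultrafilters coincide, since the limit polynomial
   determines its sorted roots. *)
Lemma sorted_roots_cvg n (A : {set 'I_n}) (X : topologicalType) (F : set_system X)
    (u : 'I_n -> X -> R) (C : R) (g : R -> R) : ProperFilter F ->
  (forall i, i \in A -> \forall x \near F, `|u i x| <= C) ->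
  (forall i j : 'I_n, i \in A -> j \in A -> (i <= j)%N -> \forall x \near F, u i x <= u j x) ->
  (forall z, (fun x => \prod_(i in A) (z - u i x)) @ F --> g z) ->
  exists l : 'I_n -> R, [/\ {in A &, forall i j : 'I_n, (i <= j)%N -> l i <= l j},
    forall z, \prod_(i in A) (z - l i) = g z & forall i, i \in A -> u i @ F --> l i].
Proof.
move=> FP uC um ug.
have ultra G : UltraFilter G -> F `<=` G -> exists l : 'I_n -> R,
    [/\ {in A &, forall i j : 'I_n, (i <= j)%N -> l i <= l j},
    forall z, \prod_(i in A) (z - l i) = g z & forall i, i \in A -> u i @ G --> l i].
  move=> GU FG; apply: (@ultra_sorted_roots n A X G u C g GU).
  - by move=> i iA; apply: FG; exact: uC.
  - by move=> i j iA jA ij; apply: FG; exact: um.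
  - move=> z N /ug; exact: FG.
have [G0 [G0U FG0]] := ultraFilterLemma FP.
have [l [lm lg _]] := ultra G0 G0U FG0.
exists l; split => // i iA N Nl; apply: contrapT => nFN.
(* If [u i] did not stay in [N] along [F], some ultrafilter finer than [F] would live on [D]; yet
   [u i] tends to [l i] along it. *)
pose D := ~` (u i @^-1` N).
have F'P : ProperFilter (within D F).
  split; last exact: within_filter.
  rewrite /within /= => F0; apply: nFN; apply: (@filterS _ F _ _ _ _ F0) => x nDx.
  by apply: contrapT => /nDx.
have [G [GU F'G]] := ultraFilterLemma F'P.
have FG : F `<=` G by move=> B FB; apply: F'G; apply: (@filterS _ F _ _ _ _ FB).
have [l' [lm' lg' ul']] := ultra G GU FG.
have ll : l' i = l i.
  by apply: (sorted_roots_unique lm' lm) => // z; rewrite lg lg'.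
have GP : ProperFilter G by exact: ultra_proper.
have GN : G (u i @^-1` N) by have := ul' i iA; rewrite ll => /(_ N Nl).
have GD : G D by apply: F'G; exact: withinT.
by have [x []] := filter_ex (filterI GN GD).
Qed.

(** Up to sign the coefficient is an elementary symmetric function of degree [size s - j], with at
    most [2 ^+ size s] terms. Beyond the degree it vanishes, while the truncated exponent is [0]. *)
Lemma coef_prod_XsubC_le (s : seq R) (M : R) (j : nat) :
  0 <= M -> (forall z, z \in s -> `|z| <= M) ->
  `|(\prod_(z <- s) ('X - z%:P))`_j| <= 2 ^+ size s * M ^+ (size s - j).
Proof.
move=> M0; elim: s j => [|z s IH] j sM.
  rewrite big_nil coef1 sub0n !expr0 mulr1.
  by case: (j == 0)%N; rewrite ?normr1 ?normr0.
rewrite big_cons mulrBl coefB coefXM coefCM /= exprS.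
have zM : `|z| <= M by apply: sM; rewrite inE eqxx.
have {}IH k : `|(\prod_(z <- s) ('X - z%:P))`_k| <= 2 ^+ size s * M ^+ (size s - k).
  by apply: IH => x xs; apply: sM; rewrite inE xs orbT.
set Q := \prod_(z <- s) ('X - z%:P) in IH *.
apply: le_trans (ler_normB _ _) _; rewrite normrM -mulrA mulr_natl mulr2n.
have K0 m : 0 <= 2 ^+ size s * M ^+ m by rewrite mulr_ge0 ?exprn_ge0.
apply: lerD.
  by case: j => [|j] /=; rewrite ?normr0 ?subSS.
have [js|js] := leqP j (size s).
  rewrite subSn// exprS mulrCA; apply: ler_pM => //; exact: IH.
rewrite [Q`_j]nth_default ?normr0 ?mulr0//.
by rewrite /Q size_prod_XsubC.
Qed.

(* The factor ['X^2] shifts indices so that [(size s).-2] does not truncate. *)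
Lemma coef_prod_XsubC_sqr (s : seq R) (Q := \prod_(z <- s) ('X - z%:P)) :
  (Q * 'X^2)`_(size s).+1 ^+ 2 - 2 * (Q * 'X^2)`_(size s) = \sum_(z <- s) z ^+ 2.
Proof.
rewrite {}/Q; elim: s => [|z s IH].
  by rewrite !big_nil mul1r !coefXn /= expr0n/= mulr0 subrr.
rewrite !big_cons -IH; set Q := \prod_(z <- s) ('X - z%:P).
have Qs : (Q * 'X^2)`_(size s).+2 = 1.
  rewrite coefMXn /= ?subSS ?subn0.
  have /monicP := monic_prod_XsubC s predT id.
  by rewrite /lead_coef size_prod_XsubC.
have E j : (('X - z%:P) * Q * 'X^2)`_j.+1 = (Q * 'X^2)`_j - z * (Q * 'X^2)`_j.+1.
  by rewrite -mulrA mulrBl coefB coefXM coefCM.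
rewrite !E Qs; ring.
Qed.

End Roots.

(** * Taylor expansions *)

Lemma cvg_near_eq (X : Type) (V : topologicalType) (F : set_system X) (FF : Filter F)
  (f g : X -> V) (l : V) : (\forall x \near F, f x = g x) -> f @ F --> l -> g @ F --> l.
Proof. by move=> fg fl; apply: cvg_trans fl; exact: near_eq_cvg. Qed.

Section Peano.
Variable R : realType.
Implicit Types (f : R -> R) (T : {poly R}) (m : nat) (q : R).

(** The expansion has order [m], but the degree of [T] is left free, so that the same [T] serves at
    every lower order. *)
Definition has_peano q m f := exists T, forall e, 0 < e ->
  \forall h \near 0, `|f (q + h) - T.[h]| <= e * `|h| ^+ m.

Lemma has_peanoD q m f g : has_peano q m f -> has_peano q m g ->
  has_peano q m (fun t => f t + g t).
Proof.
move=> [T fT] [U gU]; exists (T + U) => e e0.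
have e2 : 0 < e / 2 by rewrite divr_gt0.
have := gU _ e2; have := fT _ e2; apply: filter_app2; near=> h => h1 h2.
rewrite hornerD.
have -> : f (q + h) + g (q + h) - (T.[h] + U.[h]) =
  (f (q + h) - T.[h]) + (g (q + h) - U.[h]) by ring.
by apply: le_trans (ler_normD _ _) _; rewrite [e]splitr mulrDl lerD.
Unshelve. all: by end_near. Qed.

Lemma has_peano_cst q m (c : R) : has_peano q m (fun=> c).
Proof.
exists c%:P => e e0; near=> h.
by rewrite hornerC subrr normr0 mulr_ge0 ?exprn_ge0// ltW.
Unshelve. all: by end_near. Qed.

Lemma has_peanoZ q m (c : R) f : has_peano q m f -> has_peano q m (fun t => c * f t).
Proof.
move=> [T fT]; exists (c *: T) => e e0.
have := fT (e / (`|c| + 1)); rewrite divr_gt0// ?ltr_wpDl// => /(_ isT).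
apply: filterS => h hT; rewrite hornerZ -mulrBr normrM.
apply: (@le_trans _ _ ((`|c| + 1) * `|f (q + h) - T.[h]|)).
  by rewrite ler_wpM2r// lerDl.
by rewrite mulrC -ler_pdivlMr ?ltr_wpDl// mulrAC.
Qed.

Lemma has_peano_sum q m (I : Type) (r : seq I) (P : pred I) (F : I -> R -> R) :
  (forall i, P i -> has_peano q m (F i)) ->
  has_peano q m (fun t => \sum_(i <- r | P i) F i t).
Proof.
move=> FP; elim: r => [|i r IH].
  have -> : (fun t => \sum_(i <- [::] | P i) F i t) = fun=> 0.
    by apply/funext => t; rewrite big_nil.
  exact: has_peano_cst.
have [Pi|nPi] := boolP (P i); last first.
  suff -> : (fun t => \sum_(j <- i :: r | P j) F j t) =
    fun t => \sum_(j <- r | P j) F j t by [].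
  by apply/funext => t; rewrite big_cons (negPf nPi).
have -> : (fun t => \sum_(j <- i :: r | P j) F j t) =
    fun t => F i t + \sum_(j <- r | P j) F j t.
  by apply/funext => t; rewrite big_cons Pi.
by apply: has_peanoD => //; exact: FP.
Qed.

Lemma mean_value_le (g dg : R -> R) (q t K : R) :
  (forall x : R, is_derive x (1 : R) g (dg x)) ->
  (forall x, `|x - q| <= `|t - q| -> `|dg x| <= K) ->
  `|g t - g q| <= K * `|t - q|.
Proof.
move=> gd dgK.
have cg (a b : R) : {within `[a, b], continuous g}.
  by apply: derivable_within_continuous => x _; exact: ex_derive.
have [qt|tq] := leP q t.
  have [c /itvP cqt ->] := MVT_segment qt (fun x _ => gd x) (cg q t).
  rewrite normrM ler_wpM2r// dgK//.
  by rewrite !ger0_norm ?subr_ge0// ?lerD2r ?cqt.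
have [c /itvP cqt E] := MVT_segment (ltW tq) (fun x _ => gd x) (cg t q).
rewrite distrC E normrM [X in _ * X]distrC ler_wpM2r// dgK//.
by rewrite distrC [leRHS]distrC !ger0_norm ?subr_ge0 ?lerD2l ?lerN2 ?cqt// ltW.
Qed.

Lemma antiderivative_poly T (q c : R) : exists U : {poly R}, deriv U = T /\ U.[q] = c.
Proof.
pose V : {poly R} := \sum_(i < size T) (T`_i / i.+1%:R) *: 'X^(i.+1).
exists (V + (c - V.[q])%:P); split; last by rewrite hornerD hornerC addrC subrK.
rewrite derivD derivC addr0 /V linear_sum -[RHS]coefK poly_def.
apply: eq_bigr => i _; rewrite /= derivZ derivXn /= -scalerMnr scalerMnl -mulr_natr.
by rewrite divfK// pnatr_eq0.
Qed.

(** The expansion of the derivative is integrated, and the mean value inequality bounds the new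
    remainder; at order [0] the claim is continuity. *)
Lemma taylor_peano n f q : classC n f -> exists T, forall e, 0 < e ->
  \forall t \near q, `|f t - T.[t]| <= e * `|t - q| ^+ n.
Proof.
elim: n f => [|n IH] f [fd fc].
  exists (f q)%:P => e e0; have /cvgrPdist_le /(_ e e0) := fc q.
  by apply: filterS => t ft; rewrite hornerC distrC expr0 mulr1.
have [|T fT] := IH f^`().
  split=> [k kn x|]; first by have := fd k.+1 kn x; rewrite /derive1n iterSr.
  by move: fc; rewrite /derive1n iterSr.
have [U [UT Uq]] := antiderivative_poly T q (f q).
exists U => e e0; have /nbhs_ballP[r /= r0 rT] := fT e e0.
apply/nbhs_ballP; exists r => // t; rewrite /ball/= distrC => tr.
pose g x := f x - U.[x].
have gq : g q = 0 by rewrite /g Uq subrr.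
have -> : f t - U.[t] = g t - g q by rewrite gq subr0.
rewrite exprSr mulrA; apply: mean_value_le => [x|x xt].
  have fx : is_derive x (1 : R) f (f^`() x).
    by rewrite derive1E; apply: derivableP; exact: (fd 0%N).
  have Ux := is_derive_poly U x.
  exact: is_deriveB.
have xr : ball q r x by rewrite /ball/= distrC; exact: le_lt_trans tr.
rewrite UT; apply: le_trans (rT x xr) _; rewrite ler_pM2l//.
by rewrite lerXn2r// nnegrE.
Qed.

Lemma classC_has_peano n f q : classC n f -> has_peano q n f.
Proof.
move=> /(@taylor_peano _ _ q)[T fT]; exists (T \Po ('X + q%:P)) => e /fT.
move=> /nbhs_ballP[r /= r0 rT]; apply/nbhs_ballP; exists r => //= h.
rewrite /ball/= sub0r normrN => hr; rewrite horner_comp hornerD hornerX hornerC.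
have := rT (q + h); rewrite /ball/= opprD addrA subrr sub0r normrN => /(_ hr).
by rewrite [q + h]addrC addrK.
Qed.

Lemma nbhs_dnbhs0 (P : R -> Prop) : (\forall h \near 0, P h) -> \forall h \near 0^', P h.
Proof. by apply: cvg_within. Qed.

Lemma horner_cvg0 (U : {poly R}) : U.[h] @[h --> (0 : R)] --> U.[0].
Proof.
suff : {for (0 : R), continuous (horner U)} by [].
apply: differentiable_continuous; exact/derivable1_diffP/derivable_horner.
Qed.

(** The hypotheses force [T] to vanish to order [m] at [0], so ['X] can be divided out of [T] and
    [h] out of [f], once per step; the limit is the constant term that remains. *)
Lemma order_quotient f T m (C : R) :
  (forall e, 0 < e -> \forall h \near 0^', `|f h - T.[h]| <= e * `|h| ^+ m) ->
  (\forall h \near 0^', `|f h| <= C * `|h| ^+ m) ->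
  exists c : R, f h / h ^+ m @[h --> (0 : R)^'] --> c.
Proof.
have Tcvg (U : {poly R}) : U.[h] @[h --> (0 : R)^'] --> U.[0].
  by apply: cvg_within_filter; exact: horner_cvg0.
elim: m f T => [|m IH] f T fT fC.
  have fT0 : f h - T.[h] @[h --> (0 : R)^'] --> (0 : R).
    apply/cvgr0Pnorm_le => e e0.
    by apply: filterS (fT e e0) => h; rewrite expr0 mulr1.
  exists T.[0]; have fc : (f h - T.[h]) + T.[h] @[h --> (0 : R)^'] --> T.[0].
    by rewrite -[X in _ --> X]add0r; exact: cvgD.
  apply: cvg_near_eq fc; near=> h.
  by rewrite /= subrK expr0 divr1.
have T0 : T.[0] = 0.
  have T1 : T.[h] @[h --> (0 : R)^'] --> (0 : R).
    apply/cvgr0Pnorm_le => e e0.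
    have h1 : \forall h \near (0:R)^', `|h| < Num.min 1 (e / (`|C| + 1)).
      apply: nbhs_dnbhs0; apply: nbhs0_lt.
      by rewrite lt_min ltr01 divr_gt0// ltr_wpDl.
    have := fT 1 ltr01; move: fC h1; apply: filter_app3; near=> h => fC.
    rewrite lt_min => /andP[h1 hC] fTh.
    have hm : `|h| ^+ m.+1 <= `|h|.
      rewrite exprS; apply: ler_piMr => //; apply: exprn_ile1 => //; exact: ltW.
    have -> : T.[h] = f h - (f h - T.[h]) by ring.
    apply: le_trans (ler_normB _ _) _.
    apply: (@le_trans _ _ ((`|C| + 1) * `|h|)).
      rewrite mulrDl lerD//.
        apply: le_trans fC _; apply: le_trans (ler_norm _) _.
        by rewrite normrM ler_wpM2l// normrX normr_id.
      by apply: le_trans fTh _; rewrite !mul1r.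
    by rewrite mulrC -ler_pdivlMr ?ltr_wpDl// ltW.
  by apply: (cvg_unique _ (Tcvg T) T1); exact: norm_hausdorff.
have /factor_theorem[U TU] : root T 0 by rewrite rootE T0.
have [||c fc] := IH (fun h => f h / h) U.
- move=> e e0; have := nbhs_dnbhs_neq (0 : R); have := fT e e0.
  apply: filter_app2; near=> h => + h0.
  rewrite TU subr0 hornerM hornerX.
  have -> : f h / h - U.[h] = (f h - U.[h] * h) / h by field.
  by rewrite normrM normfV ler_pdivrMr ?normr_gt0// exprSr mulrA.
- have := nbhs_dnbhs_neq (0 : R); have := fC; apply: filter_app2; near=> h => + h0.
  by rewrite normrM normfV ler_pdivrMr ?normr_gt0// exprSr mulrA.
exists c; apply: cvg_near_eq fc; near=> h.
by rewrite exprS invfM mulrA.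
Unshelve. all: by end_near. Qed.

Lemma has_peano_continuous q m f : has_peano q m f ->
  f (q + h) @[h --> (0 : R)] --> f q.
Proof.
move=> [T fT].
have bound e h : 0 < e -> `|h| < 1 -> `|f (q + h) - T.[h]| <= e * `|h| ^+ m ->
    `|f (q + h) - T.[h]| <= e.
  move=> e0 h1 hT; apply: le_trans hT _; apply: ler_piMr; first exact: ltW.
  by apply: exprn_ile1 => //; exact: ltW.
have d0 : f (q + h) - T.[h] @[h --> (0 : R)] --> (0 : R).
  apply/cvgr0Pnorm_le => e e0; have h1 := @nbhs0_lt R R 1 ltr01.
  by apply: filterS2 (fT e e0) h1 => h hT h1'; exact: bound.
have fq : f q = T.[0].
  apply/eqP; rewrite -subr_eq0 -normr_le0; apply/ler_addgt0Pr => e e0.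
  rewrite add0r -[in f q](addr0 q); apply: bound => //; first by rewrite normr0.
  exact: (nbhs_singleton (fT e e0)).
have Tc := @horner_cvg0 T.
have fc : (f (q + h) - T.[h]) + T.[h] @[h --> (0 : R)] --> f q.
  by rewrite fq -[X in _ --> X]add0r; exact: cvgD.
by apply: cvg_near_eq fc; near=> h; rewrite subrK.
Unshelve. all: by end_near. Qed.

Lemma has_peanoW q m m' f : (m' <= m)%N -> has_peano q m f -> has_peano q m' f.
Proof.
move=> mm [T fT]; exists T => e e0; have h1 := @nbhs0_lt R R 1 ltr01.
apply: filterS2 (fT e e0) h1 => h hT h1'; apply: le_trans hT _.
by rewrite ler_pM2l//; apply: ler_wiXn2l => //; exact: ltW.
Qed.

Lemma has_peano_quotient f m (C : R) : has_peano 0 m f ->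
  (\forall h \near 0^', `|f h| <= C * `|h| ^+ m) ->
  exists c : R, f h / h ^+ m @[h --> (0 : R)^'] --> c.
Proof.
move=> [T fT]; apply: (@order_quotient f T) => e /fT fe.
by apply: nbhs_dnbhs0; apply: filterS fe => h; rewrite add0r.
Qed.

Lemma dnbhs_right_left (P : R -> Prop) : (\forall h \near 0^', P h) ->
  (\forall h \near 0^'+, P h) /\ (\forall h \near 0^'-, P h).
Proof.
move=> [r r0 rP]; split; exists r => // h hr h0; apply: (rP h hr).
  by rewrite gt_eqF.
by rewrite lt_eqF.
Qed.

Lemma has_peano_factor f m : has_peano 0 m.+1 f ->
  f h @[h --> (0 : R)^'] --> (0 : R) ->
  f 0 = 0 /\ exists U : {poly R}, forall e, 0 < e ->
    \forall h \near 0, `|f h - U.[h] * h| <= e * `|h| ^+ m.+1.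
Proof.
move=> fp f0; have fc := has_peano_continuous fp.
have [T fT] := fp.
have fc0 : f h @[h --> (0 : R)^'] --> f 0.
  apply: cvg_within_filter; apply: cvg_near_eq fc; near=> h; by rewrite add0r.
have f00 : f 0 = 0 by apply: (cvg_unique _ fc0 f0); exact: norm_hausdorff.
have T0 : T.[0] = 0.
  apply/eqP; have := nbhs_singleton (fT 1 ltr01).
  by rewrite addr0 f00 normr0 expr0n/= mulr0 normr_le0 sub0r oppr_eq0.
have /factor_theorem[U TU] : root T 0 by rewrite rootE T0.
split => //; exists U => e /fT; apply: filterS => h.
by rewrite add0r TU subr0 hornerM hornerX.
Unshelve. all: by end_near. Qed.

Lemma has_peano_le_norm f m : (0 < m)%N -> has_peano 0 m f ->
  f h @[h --> (0 : R)^'] --> (0 : R) ->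
  exists C, \forall h \near 0^', `|f h| <= C * `|h|.
Proof.
move=> m0 fp f0; have [_ [U fU]] := has_peano_factor (has_peanoW m0 fp) f0.
have /cvgrPdist_le /(_ 1 ltr01) U1 := @horner_cvg0 U.
(* The [2] pays for the remainder and for the variation of [U], each contributing at most the norm
   of [h]. *)
exists (`|U.[0]| + 2); apply: nbhs_dnbhs0.
apply: filterS2 (fU 1 ltr01) U1 => h; rewrite expr1 => h1 h2.
have -> : f h = (f h - U.[h] * h) + (U.[h] - U.[0]) * h + U.[0] * h by ring.
apply: le_trans (ler_normD _ _) _.
apply: (@le_trans _ _ ((1 * `|h| + 1 * `|h|) + `|U.[0]| * `|h|)).
  rewrite [`|U.[0] * h|]normrM lerD2r; apply: le_trans (ler_normD _ _) _; apply: lerD => //.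
  by rewrite normrM ler_wpM2r// distrC.
by rewrite -!mulrDl addrC.
Qed.

(** The expansion includes [h = 0], where the quotient is [0] by convention; the last hypothesis
    makes this the value at [0] of the new polynomial. *)
Lemma has_peano_div f m : has_peano 0 m.+1 f -> f h @[h --> (0 : R)^'] --> (0 : R) ->
  f h / h @[h --> (0 : R)^'] --> (0 : R) -> has_peano 0 m (fun h => f h / h).
Proof.
move=> fp f0 fh0; have [f00 [U fU]] := has_peano_factor fp f0.
have fUh e : 0 < e -> \forall h \near 0^', `|f h / h - U.[h]| <= e * `|h| ^+ m.
  move=> e0; have := nbhs_dnbhs_neq (0 : R); have := nbhs_dnbhs0 (fU e e0).
  apply: filter_app2; near=> h => + h0.
  have -> : f h / h - U.[h] = (f h - U.[h] * h) / h by field.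
  by rewrite normrM normfV ler_pdivrMr ?normr_gt0// exprSr mulrA.
have U0 : U.[0] = 0.
  have d0 : f h / h - U.[h] @[h --> (0 : R)^'] --> (0 : R).
    apply/cvgr0Pnorm_le => e e0; have h1 := nbhs_dnbhs0 (@nbhs0_lt R R 1 ltr01).
    apply: filterS2 (fUh e e0) h1 => h hT h1'; apply: le_trans hT _.
    apply: ler_piMr; first exact: ltW.
    by apply: exprn_ile1 => //; exact: ltW.
  have U0 : U.[h] @[h --> (0 : R)^'] --> (0 : R).
    have : f h / h - (f h / h - U.[h]) @[h --> (0 : R)^'] --> (0 : R).
      by rewrite -[X in _ --> X]subr0; exact: cvgB.
    by apply: cvg_near_eq; near=> h; rewrite opprB addrC subrK.
  apply: (cvg_unique _ _ U0); first exact: norm_hausdorff.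
  by apply: cvg_within_filter; exact: horner_cvg0.
exists U => e e0; have [r r0 rP] := fUh e e0; exists r => // h hr; rewrite add0r.
have [->|h0] := eqVneq h 0; last exact: rP.
by rewrite f00 mul0r U0 subrr normr0 mulr_ge0 ?exprn_ge0// ltW.
Unshelve. all: by end_near. Qed.

(* A linear term of [f c] would change sign at [0], against the one-sided bound. *)
Lemma has_peano_le_sqr f (c : R -> R) (C rho : R) : has_peano 0 2 f ->
  f h @[h --> (0 : R)^'] --> (0 : R) -> c h @[h --> (0 : R)^'] --> rho -> rho != 0 ->
  (\forall h \near 0^', f h * c h <= C * h ^+ 2) ->
  exists C', \forall h \near 0^', `|f h| <= C' * h ^+ 2.
Proof.
move=> fp f0 cr rho0 fC.
have [K fK] := has_peano_le_norm (isT : (0 < 2)%N) fp f0.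
have [al fal] : exists al : R, f h / h ^+ 1 @[h --> (0 : R)^'] --> al.
  by apply: (@has_peano_quotient f 1 K); [exact: has_peanoW fp|exact: fK].
have facr : f h / h ^+ 1 * c h @[h --> (0 : R)^'] --> al * rho by exact: cvgM.
have Ch : C * h @[h --> (0 : R)^'] --> (0 : R).
  rewrite -[X in _ --> X](mulr0 C); apply: cvgM; first exact: cvg_cst.
  by apply: cvg_within_filter; exact: cvg_id.
have al0 : al = 0.
  have : al * rho = 0.
    apply/eqP; rewrite eq_le; apply/andP; split.
      apply: (ler_cvg_to (cvg_dnbhs_at_right facr) (cvg_dnbhs_at_right Ch)).
      have hgt := @nbhs_right_gt R 0; have [fC' _] := dnbhs_right_left fC.
      move: fC' hgt; apply: filter_app2; near=> h => h1 h0.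
      have -> : f h / h ^+ 1 * c h = (f h * c h) / h by rewrite expr1 mulrAC.
      by rewrite ler_pdivrMr// -mulrA -expr2.
    apply: (ler_cvg_to (cvg_dnbhs_at_left Ch) (cvg_dnbhs_at_left facr)).
    have hlt := @nbhs_left_lt R 0; have [_ fC'] := dnbhs_right_left fC.
    move: fC' hlt; apply: filter_app2; near=> h => h1 h0.
    have -> : f h / h ^+ 1 * c h = (f h * c h) / h by rewrite expr1 mulrAC.
    by rewrite ler_ndivlMr// -mulrA -expr2.
  by move=> /eqP; rewrite mulf_eq0 (negPf rho0) orbF => /eqP.
rewrite al0 in fal; have fal1 : f h / h @[h --> (0 : R)^'] --> (0 : R).
  by apply: cvg_near_eq fal; near=> h; rewrite expr1.
have [C' fC'] := has_peano_le_norm (ltnSn 0) (has_peano_div fp f0 fal1) fal1.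
exists C'; have := nbhs_dnbhs_neq (0 : R); move: fC'; apply: filter_app2.
near=> h => + h0; rewrite normrM normfV ler_pdivrMr ?normr_gt0//.
by rewrite -mulrA -expr2 real_normK// num_real.
Unshelve. all: by end_near. Qed.

End Peano.

(** * A cluster of roots *)

Section CoefEstimates.
Variable R : realType.
Variables (s : seq R) (r : {poly R}) (M K : R).
Hypotheses (M0 : 0 <= M) (M1 : M <= 1).
Hypothesis sM : forall z, z \in s -> `|z| <= M.
Hypothesis rK : forall j, `|r`_j| <= K.
Let Q := \prod_(z <- s) ('X - z%:P).
Let k := size s.

(** In the convolution, coefficient [i] of [Q] is of size [M ^+ (k - i)]; since [M <= 1], the term
    [i = j] has the weakest bound. *)
Lemma coef_mul_le j : `|(Q * r)`_j| <= j.+1%:R * (2 ^+ k * K) * M ^+ (k - j).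
Proof.
rewrite coefM; apply: le_trans (ler_norm_sum _ _ _) _.
apply: (@le_trans _ _ (\sum_(i < j.+1) (2 ^+ k * K) * M ^+ (k - j))); last first.
  by rewrite sumr_const card_ord -[_ *+ _]mulr_natl [leLHS]mulrA lexx.
apply: ler_sum => i _; rewrite normrM mulrAC; apply: ler_pM => //.
apply: le_trans (coef_prod_XsubC_le i M0 sM) _; rewrite ler_wpM2l ?exprn_ge0//.
by apply: ler_wiXn2l => //; rewrite leq_sub2l// -ltnS.
Qed.

(** Removing the term [i = j] of the convolution gains one more power of [M]. *)
Lemma coef_mul_sub_le j : (j <= k)%N ->
  `|(Q * r)`_j - Q`_j * r`_0| <= j%:R * (2 ^+ k * K) * M ^+ (k - j).+1.
Proof.
move=> jk; rewrite coefM big_ord_recr /= subnn addrK.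
apply: le_trans (ler_norm_sum _ _ _) _.
apply: (@le_trans _ _ (\sum_(i < j) (2 ^+ k * K) * M ^+ (k - j).+1)); last first.
  by rewrite sumr_const card_ord -[_ *+ _]mulr_natl [leLHS]mulrA lexx.
apply: ler_sum => i _; rewrite normrM mulrAC; apply: ler_pM => //.
apply: le_trans (coef_prod_XsubC_le i M0 sM) _; rewrite ler_wpM2l ?exprn_ge0//.
by apply: ler_wiXn2l => //; apply: ltn_sub2l (ltn_ord i); exact: leq_trans (ltn_ord i) jk.
Qed.

End CoefEstimates.

Lemma normM_le (R : realType) (x y a b : R) : `|x| <= a -> `|y| <= b -> `|x * y| <= a * b.
Proof. by move=> xa yb; rewrite normrM ler_pM. Qed.

(** Here [a], [b], [c] are perturbations of [qa * r], [qb * r], [r]. Expanding leaves nine error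
    terms, each at most [E ^+ 3 * M ^+ 3]. *)
Lemma discriminant_estimate (R : realType) (a b c qa qb r M E p2 : R) :
  0 <= M -> M <= 1 -> 1 <= E -> `|qa| <= E * M -> `|qb| <= E * M ^+ 2 ->
  `|r| <= E -> `|a - qa * r| <= E * M ^+ 2 -> `|b - qb * r| <= E * M ^+ 3 ->
  `|c - r| <= E * M -> qa ^+ 2 - 2 * qb = p2 ->
  `|a ^+ 2 - 2 * (b * c) - r ^+ 2 * p2| <= 9 * E ^+ 3 * M ^+ 3.
Proof.
move=> M0 M1 E1 qaE qbE rE; set e1 := a - _; set e2 := b - _; set e3 := c - _.
move=> e1E e2E e3E <-; have E0 : 0 <= E by apply: le_trans E1.
have -> : a ^+ 2 - 2 * (b * c) - r ^+ 2 * (qa ^+ 2 - 2 * qb) =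
    (qa * r * e1) + (qa * r * e1) + e1 * e1 - (qb * r * e3 + qb * r * e3) -
    (e2 * r + e2 * r) - (e2 * e3 + e2 * e3).
  by rewrite /e1 /e2 /e3; ring.
set X := E ^+ 3 * M ^+ 3.
have X0 : 0 <= X by rewrite mulr_ge0 ?exprn_ge0.
have M3 : M ^+ 4 <= M ^+ 3 by apply: ler_wiXn2l.
have E2 : E ^+ 2 <= E ^+ 3 by apply: ler_weXn2l.
have h1 : `|qa * r * e1| <= X.
  apply: le_trans (normM_le (normM_le qaE rE) e1E) _.
  by rewrite [leLHS](_ : _ = X)//; rewrite /X; ring.
have X2 : E ^+ 2 * M ^+ 4 <= X by rewrite ler_pM ?exprn_ge0.
have X3 : E ^+ 2 * M ^+ 3 <= X by rewrite ler_wpM2r ?exprn_ge0.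
have h2 : `|e1 * e1| <= X.
  apply: le_trans (normM_le e1E e1E) _; apply: le_trans X2.
  by rewrite [leLHS](_ : _ = E ^+ 2 * M ^+ 4)//; ring.
have h3 : `|qb * r * e3| <= X.
  apply: le_trans (normM_le (normM_le qbE rE) e3E) _.
  by rewrite [leLHS](_ : _ = X)//; rewrite /X; ring.
have h4 : `|e2 * r| <= X.
  apply: le_trans (normM_le e2E rE) _; apply: le_trans X3.
  by rewrite [leLHS](_ : _ = E ^+ 2 * M ^+ 3)//; ring.
have h5 : `|e2 * e3| <= X.
  apply: le_trans (normM_le e2E e3E) _; apply: le_trans X2.
  by rewrite [leLHS](_ : _ = E ^+ 2 * M ^+ 4)//; ring.
have -> : 9 * E ^+ 3 * M ^+ 3 = 9 * X by rewrite /X mulrA.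
move: (qa * r * e1) (e1 * e1) (qb * r * e3) (e2 * r) (e2 * e3) h1 h2 h3 h4 h5.
move: (X) => Y u1 u2 u3 u4 u5 h1 h2 h3 h4 h5.
move: h1 h2 h3 h4 h5; rewrite !ler_norml => /andP[? ?] /andP[? ?] /andP[? ?] /andP[? ?] /andP[? ?].
by apply/andP; split; lra.
Qed.

Section Cluster.
Variables (R : realType) (n : nat) (A : {set 'I_n}) (z : 'I_n -> R -> R) (b : 'I_n -> R).
Hypothesis A_nonempty : (0 < #|A|)%N.
Hypothesis z_small : forall i, i \in A -> z i h @[h --> (0 : R)^'] --> (0 : R).
Hypothesis z_large : forall i, i \notin A -> z i h @[h --> (0 : R)^'] --> b i.
Hypothesis b_neq0 : forall i, i \notin A -> b i != 0.
Let P h := \prod_(i < n) ('X - (z i h)%:P).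
Hypothesis P_peano : forall j, has_peano 0 n (fun h => (P h)`_j).
Let k := #|A|.
Let Q h := \prod_(i in A) ('X - (z i h)%:P).
Let r h := \prod_(i in ~: A) ('X - (z i h)%:P).
Let p2 h := \sum_(i in A) z i h ^+ 2.
(** A common size for the cluster: it bounds every small root, and its square is a polynomial in the
    coefficients of [Q h]. *)
Let M h := Num.sqrt (p2 h).
Let rho := \prod_(i in ~: A) (0 - b i).

Let p2_ge0 h : 0 <= p2 h.
Proof. by apply: sumr_ge0 => i _; exact: sqr_ge0. Qed.

Let M_ge0 h : 0 <= M h. Proof. exact: sqrtr_ge0. Qed.

Let M_sqr h : M h ^+ 2 = p2 h. Proof. by rewrite sqr_sqrtr. Qed.

Let z_le_M i h : i \in A -> `|z i h| <= M h.
Proof.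
move=> iA; rewrite -sqrtr_sqr; apply: ler_wsqrtr.
by rewrite /p2 (bigD1 i)//= lerDl; apply: sumr_ge0 => j _; exact: sqr_ge0.
Qed.

Let PE h : P h = Q h * r h.
Proof.
rewrite /P (bigID (mem A)) /=; congr (_ * _); apply: eq_bigl => i.
by rewrite inE.
Qed.

Let QE h : Q h = \prod_(w <- [seq z i h | i <- enum A]) ('X - w%:P).
Proof. by rewrite big_map big_enum. Qed.

Let size_s h : size [seq z i h | i <- enum A] = k.
Proof. by rewrite size_map -cardE. Qed.

Let s_le_M h w : w \in [seq z i h | i <- enum A] -> `|w| <= M h.
Proof. by move=> /mapP[i]; rewrite mem_enum => iA ->; exact: z_le_M. Qed.

Let M_small e : 0 < e -> \forall h \near (0 : R)^', M h < e.
Proof.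
move=> e0; have p0 : p2 h @[h --> (0 : R)^'] --> (0 : R).
  have s0 : (0 : R) = \sum_(i in A) (0 : R) ^+ 2 by rewrite big1// => i _; rewrite expr0n.
  rewrite [X in _ --> X]s0.
  apply: cvg_big => [|i iA]; first exact: add_continuous.
  have zz : z i h * z i h @[h --> (0 : R)^'] --> (0 : R) * 0.
    by apply: cvgM; exact: z_small.
  have zz2 : z i h ^+ 2 @[h --> (0 : R)^'] --> (0 : R) ^+ 2.
    by rewrite [X in _ --> X]expr2; apply: cvg_near_eq zz; near=> h; rewrite expr2.
  exact: zz2.
have /cvgr0Pnorm_lt /(_ (e ^+ 2)) := p0; rewrite exprn_gt0// => /(_ isT).
apply: filterS => h; rewrite ger0_norm// -M_sqr => Me.
by rewrite -(@ltr_pXn2r _ 2)// ?nnegrE// ltW.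
Unshelve. all: by end_near. Qed.

Let r_bounded : exists K, \forall h \near (0 : R)^', forall j, `|(r h)`_j| <= K.
Proof.
pose B := 1 + \sum_(i < n) `|b i|.
have bB i : `|b i| + 1 <= B.
  by rewrite addrC lerD2l (bigD1 i)//= lerDl sumr_ge0.
have B1 : 1 <= B by rewrite lerDl sumr_ge0.
exists (2 ^+ #|~: A| * B ^+ #|~: A|).
have zB : \forall h \near (0 : R)^', forall i, i \in ~: A -> `|z i h| <= B.
  apply: filter_forall => i; have [iA|iA] := boolP (i \in ~: A); last by near=> h.
  move: iA; rewrite inE => iA; have /cvgrPdist_le /(_ 1 ltr01) := z_large iA.
  apply: filterS => h hb _; apply: le_trans (bB i).
  have -> : z i h = b i - (b i - z i h) by ring.
  by apply: le_trans (ler_normB _ _) _; rewrite lerD2l.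
apply: filterS zB => h zB j.
have -> : r h = \prod_(w <- [seq z i h | i <- enum (~: A)]) ('X - w%:P).
  by rewrite big_map big_enum.
apply: le_trans (@coef_prod_XsubC_le _ _ B j _ _) _; first exact: le_trans B1.
  by move=> w /mapP[i]; rewrite mem_enum => iA ->; exact: zB.
rewrite size_map -cardE ler_wpM2l ?exprn_ge0//.
by apply: ler_weXn2l => //; exact: leq_subr.
Unshelve. all: by end_near. Qed.

Let rho_neq0 : rho != 0.
Proof.
by apply/prodf_neq0 => i; rewrite inE => iA; rewrite sub0r oppr_eq0 b_neq0.
Qed.

Let prod_large_cvg w : \prod_(i in ~: A) (h * w - z i h) @[h --> (0 : R)^'] --> rho.
Proof.
apply: cvg_big => [x|i iA]; first exact: mul_continuous.
apply: cvgB; last by apply: z_large; move: iA; rewrite inE.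
rewrite -[X in _ --> X](mul0r w); apply: cvgM; last exact: cvg_cst.
by apply: cvg_within_filter; exact: cvg_id.
Qed.

Let r0_cvg : (r h)`_0 @[h --> (0 : R)^'] --> rho.
Proof.
apply: cvg_near_eq (prod_large_cvg 0); near=> h.
rewrite -horner_coef0 horner_prod_XsubC; apply: eq_bigr => i _.
by rewrite mulr0.
Unshelve. all: by end_near. Qed.

Let k_le_n : (k <= n)%N.
Proof. by rewrite -[n in (_ <= n)%N]card_ord; exact: max_card. Qed.

Lemma coef_cluster_le : exists K, \forall h \near (0 : R)^',
  forall j, (j <= n)%N -> `|(P h)`_j| <= K * M h ^+ (k - j).
Proof.
have [K rK] := r_bounded; exists (n.+1%:R * (2 ^+ k * K)).
have M1 := M_small ltr01; apply: filterS2 rK M1 => h rK /ltW M1 j jn.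
have K0 : 0 <= K by apply: le_trans (rK 0%N).
rewrite PE QE; apply: le_trans (coef_mul_le (M_ge0 h) M1 (@s_le_M h) rK j) _.
rewrite size_s ler_wpM2r ?exprn_ge0//.
by rewrite ler_wpM2r ?mulr_ge0 ?exprn_ge0// ler_nat.
Qed.

Lemma coef_cluster_cvg0 j : (j < k)%N -> (P h)`_j @[h --> (0 : R)^'] --> (0 : R).
Proof.
move=> jk; have [K PK] := coef_cluster_le; apply/cvgr0Pnorm_le => e e0.
have K1 : 0 < `|K| + 1 by rewrite ltr_wpDl.
have Me : \forall h \near (0 : R)^', M h < Num.min 1 (e / (`|K| + 1)).
  by apply: M_small; rewrite lt_min ltr01 divr_gt0.
apply: filterS2 PK Me => h PK; rewrite lt_min => /andP[M1 Me].
apply: le_trans (PK j _) _; first exact: leq_trans (ltnW jk) k_le_n.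
apply: (@le_trans _ _ ((`|K| + 1) * M h)).
  apply: (@le_trans _ _ (`|K| * M h ^+ (k - j))).
    by rewrite ler_wpM2r ?exprn_ge0// ler_norm.
  apply: ler_pM => //; rewrite ?exprn_ge0// ?lerDl//.
  rewrite -[leRHS]expr1; apply: ler_wiXn2l; rewrite ?subn_gt0//; exact: ltW.
by rewrite mulrC -ler_pdivlMr// ltW.
Qed.

(** The coefficients of [P h] in degrees [k], [k - 1], [k - 2] are those of [Q h] times the constant
    term of [r h], up to one more power of [M h]; for [Q h] the combination is the sum of squares
    [p2 h]. The factor ['X^2] makes the last coefficient [0] when [k = 1]. *)
Lemma coef_cluster_discriminant : exists2 E, 1 <= E & \forall h \near (0 : R)^',
  `|(P h)`_k - (r h)`_0| <= E * M h /\
  `|(P h * 'X^2)`_k.+1 ^+ 2 - 2 * ((P h * 'X^2)`_k * (P h)`_k) - (r h)`_0 ^+ 2 * p2 h|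
    <= 9 * E ^+ 3 * M h ^+ 3.
Proof.
have [K rK] := r_bounded; pose E := n.+1%:R * (2 ^+ k * (`|K| + 1)).
have n1 : 1 <= n.+1%:R :> R by rewrite ler1n.
have k1 : 1 <= 2 ^+ k :> R by rewrite exprn_ege1// ler1n.
have K1 : 1 <= `|K| + 1 by rewrite lerDr.
have K01 : 0 <= `|K| + 1 by rewrite addr_ge0.
have E1 : 1 <= E by rewrite mulr_ege1// mulr_ege1.
have Ek : 2 ^+ k <= E.
  apply: le_trans (ler_peMl _ n1); rewrite ?mulr_ge0 ?exprn_ge0//.
  by apply: ler_peMr; rewrite ?exprn_ge0.
have EK : `|K| <= E.
  apply: (@le_trans _ _ (`|K| + 1)); first by rewrite lerDl.
  apply: le_trans (ler_peMl _ n1); rewrite ?mulr_ge0 ?exprn_ge0//.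
  exact: ler_peMl.
have Ej j : (j <= n)%N -> j%:R * (2 ^+ k * K) <= E.
  move=> jn; apply: (@le_trans _ _ (j%:R * (2 ^+ k * (`|K| + 1)))).
    rewrite ler_wpM2l// ler_wpM2l ?exprn_ge0//.
    by apply: le_trans (ler_norm _) _; rewrite lerDl.
  by apply: ler_wpM2r; rewrite ?mulr_ge0 ?exprn_ge0// ler_nat ltnW.
exists E => //; have M1 := M_small ltr01; apply: filterS2 rK M1 => h rK /ltW M1.
have sub j : (j <= k)%N -> `|(P h)`_j - (Q h)`_j * (r h)`_0| <= E * M h ^+ (k - j).+1.
  move=> jk; rewrite PE QE.
  apply: le_trans (coef_mul_sub_le (M_ge0 h) M1 (@s_le_M h) rK _) _.
    by rewrite size_s.
  rewrite size_s ler_wpM2r ?exprn_ge0//; apply: Ej; exact: leq_trans jk k_le_n.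
have Qj j : `|(Q h)`_j| <= E * M h ^+ (k - j).
  rewrite QE; apply: le_trans (coef_prod_XsubC_le j (M_ge0 h) (@s_le_M h)) _.
  by rewrite size_s ler_wpM2r ?exprn_ge0.
have E0 : 0 <= E by apply: le_trans E1.
have Qk : (Q h)`_k = 1.
  have /monicP := monic_prod_XsubC [seq z i h | i <- enum A] predT id.
  by rewrite /lead_coef size_prod_XsubC QE size_s.
have ck : `|(P h)`_k - (r h)`_0| <= E * M h.
  by have := sub k (leqnn k); rewrite Qk mul1r subnn expr1.
split => //.
apply: (@discriminant_estimate R _ _ _ (Q h * 'X^2)`_k.+1 (Q h * 'X^2)`_k) => //.
- rewrite coefMXn; case: ifP => _; first by rewrite normr0 mulr_ge0.
  have := Qj (k.+1 - 2)%N; rewrite subSS subKn ?expr1//.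
- rewrite coefMXn; case: ifPn => k2; first by rewrite normr0 mulr_ge0 ?exprn_ge0.
  by have := Qj (k - 2)%N; rewrite subKn// leqNgt.
- by apply: le_trans (rK 0%N) _; apply: le_trans (ler_norm _) _.
- rewrite !coefMXn; case: ifPn => k1'; first by move: k1'; rewrite ltnS ltnNge A_nonempty.
  by have := sub (k.+1 - 2)%N (leq_subr _ _); rewrite subSS subKn.
- rewrite !coefMXn; case: ifPn => k2.
    by rewrite mul0r subr0 normr0 mulr_ge0 ?exprn_ge0.
  have := sub (k - 2)%N (leq_subr _ _); rewrite subKn; last by rewrite leqNgt.
  exact.
- have := coef_prod_XsubC_sqr [seq z i h | i <- enum A].
  by rewrite size_s -QE => ->; rewrite big_map big_enum.
Qed.

(** By the discriminant estimate, [a ^+ 2 - 2 * b' * c] dominates a positive multiple of [M ^+ 2].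
    Its nonnegativity and [a = O(h)] bound [b' * c] from above, which the expansion of [b'] turns
    into [b' = O(h ^+ 2)]; feeding this back gives [M = O(h)]. *)
Lemma cluster_M_le : exists C, \forall h \near (0 : R)^', M h <= C * `|h|.
Proof.
have [E E1 est] := coef_cluster_discriminant.
have E0 : 0 < E by apply: lt_le_trans E1.
pose a h := (P h * 'X^2)`_k.+1; pose b' h := (P h * 'X^2)`_k; pose c h := (P h)`_k.
have aE : a = fun h => (P h)`_k.-1.
  apply/funext => h; rewrite /a coefMXn ltnS ltnNge A_nonempty /=.
  by rewrite subSS subn1.
have [a0 ap] : a h @[h --> (0 : R)^'] --> (0 : R) /\ has_peano 0 n a.
  rewrite aE; split; last exact: P_peano.
  by apply: coef_cluster_cvg0; rewrite ltn_predL.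
have [b0 bp] : b' h @[h --> (0 : R)^'] --> (0 : R) /\ has_peano 0 2 b'.
  (* For a single root the coefficient is identically [0]; otherwise [n >= 2] and the expansion
     reaches order [2]. *)
  have [k2|k2] := ltnP k 2.
    have -> : b' = fun=> 0 by apply/funext => h; rewrite /b' coefMXn k2.
    by split; [exact: cvg_cst|exact: has_peano_cst].
  have -> : b' = fun h => (P h)`_(k - 2).
    by apply/funext => h; rewrite /b' coefMXn ltnNge k2.
  split; last by apply: has_peanoW (P_peano _); exact: leq_trans k_le_n.
  by apply: coef_cluster_cvg0; rewrite ltn_subrL.
have c_rho : c h @[h --> (0 : R)^'] --> rho.
  have d0 : c h - (r h)`_0 @[h --> (0 : R)^'] --> (0 : R).
    apply/cvgr0Pnorm_le => e e0; have Me := M_small (divr_gt0 e0 E0).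
    apply: filterS2 est Me => h [cM _] Me; apply: le_trans cM _.
    by rewrite mulrC -ler_pdivlMr// ltW.
  have cc : c h - (r h)`_0 + (r h)`_0 @[h --> (0 : R)^'] --> rho.
    by rewrite -[X in _ --> X]add0r; apply: cvgD d0 r0_cvg.
  by apply: cvg_near_eq cc; near=> h; rewrite subrK.
have rho2 : 0 < rho ^+ 2 by rewrite exprn_even_gt0.
have [Ca aC] := has_peano_le_norm (leq_trans A_nonempty k_le_n) ap a0.
have key : \forall h \near (0 : R)^', rho ^+ 2 / 4 * M h ^+ 2 <= a h ^+ 2 - 2 * (b' h * c h).
  have rr : (r h)`_0 * (r h)`_0 @[h --> (0 : R)^'] --> rho * rho.
    by apply: cvgM; exact: r0_cvg.
  have /cvgrPdist_le /(_ (rho ^+ 2 / 2)) := rr; rewrite divr_gt0// => /(_ isT) rr2.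
  (* With [36 = 4 * 9], this bound keeps the error below [rho ^+ 2 / 4 * M h ^+ 2], while the
     squared constant term of [r h] stays above [rho ^+ 2 / 2]. *)
  have Me := M_small (divr_gt0 rho2 (mulr_gt0 (ltr0Sn R 35) (exprn_gt0 3 E0))).
  apply: filterS3 est rr2 Me => h [_ dE] r2 Me.
  have M3 : 9 * E ^+ 3 * M h ^+ 3 <= rho ^+ 2 / 4 * M h ^+ 2.
    rewrite [M h ^+ 3]exprS mulrA ler_wpM2r ?exprn_ge0//.
    move: Me; rewrite ltr_pdivlMr ?mulr_gt0 ?exprn_gt0// => Me; nra.
  move: dE; rewrite ler_norml -/(a h) -/(b' h) -/(c h) -M_sqr => /andP[dE _].
  move: r2; rewrite -!expr2 ler_norml => /andP[_ r2].
  have := ler_wpM2r (exprn_ge0 2 (M_ge0 h)) r2; rewrite mulrBl => r2'.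
  move: dE r2' M3; move: (M h ^+ 2) (9 * E ^+ 3 * M h ^+ 3) ((r h)`_0 ^+ 2) (rho ^+ 2).
  move: (a h ^+ 2) (b' h * c h) => x1 x2 x3 x4 x5 x6; lra.
(* Dropping the nonnegative left side of [key] leaves [2 * b' * c <= a ^+ 2]. *)
have bc_le : \forall h \near (0 : R)^', b' h * c h <= Ca ^+ 2 / 2 * h ^+ 2.
  apply: filterS2 key aC => h ky ah.
  have a2 : a h ^+ 2 <= Ca ^+ 2 * h ^+ 2.
    rewrite -exprMn -[a h ^+ 2]real_normK ?num_real// -[leRHS]real_normK ?num_real//.
    apply: lerXn2r; rewrite ?nnegrE// normrM.
    apply: le_trans ah _; apply: ler_wpM2r => //; exact: ler_norm.
  have : 0 <= rho ^+ 2 / 4 * M h ^+ 2 by rewrite mulr_ge0 ?exprn_ge0// ltW// divr_gt0.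
  move: ky a2; move: (_ / 4 * _) (Ca ^+ 2) (h ^+ 2) (a h ^+ 2) (b' h * c h) => x1 x2 x3 x4 x5; nra.
have [Cb bC] := has_peano_le_sqr bp b0 c_rho rho_neq0 bc_le.
have /cvgrPdist_le /(_ 1 ltr01) c1 := c_rho.
pose D := (Ca ^+ 2 + 2 * (Cb * (`|rho| + 1))) / (rho ^+ 2 / 4).
exists (Num.sqrt `|D|).
have bc1 : \forall h \near (0 : R)^', `|b' h| <= Cb * h ^+ 2 /\ `|rho - c h| <= 1.
  exact: filterI bC c1.
apply: filterS3 key aC bc1 => h ky ah [bh ch].
have c_le : `|c h| <= `|rho| + 1.
  have -> : c h = rho - (rho - c h) by ring.
  by apply: le_trans (ler_normB _ _) _; rewrite lerD2l.
have a2 : a h ^+ 2 <= Ca ^+ 2 * h ^+ 2.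
  rewrite -exprMn -[a h ^+ 2]real_normK ?num_real// -[leRHS]real_normK ?num_real//.
  apply: lerXn2r; rewrite ?nnegrE// normrM.
  apply: le_trans ah _; apply: ler_wpM2r => //; exact: ler_norm.
have bcn := normM_le bh c_le.
have MD : M h ^+ 2 <= D * h ^+ 2.
  rewrite /D mulrAC ler_pdivlMr ?divr_gt0// mulrC.
  move: bcn; rewrite ler_norml => /andP[bcn _].
  have -> : (Ca ^+ 2 + 2 * (Cb * (`|rho| + 1))) * h ^+ 2 =
    Ca ^+ 2 * h ^+ 2 + 2 * (Cb * h ^+ 2 * (`|rho| + 1)) by ring.
  move: ky a2 bcn; move: (_ / 4 * _) (Ca ^+ 2 * _) (a h ^+ 2) (b' h * c h) (Cb * _ * _).
  by move=> x1 x2 x3 x4 x5; lra.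
rewrite -[`|h|]sqrtr_sqr -sqrtrM// -[M h]ger0_norm// -[`|M h|]sqrtr_sqr; apply: ler_wsqrtr.
apply: le_trans MD _; rewrite ler_wpM2r ?sqr_ge0//; exact: ler_norm.
Unshelve. all: by end_near. Qed.

Lemma cluster_le : exists C, forall i, i \in A -> \forall h \near (0 : R)^', `|z i h| <= C * `|h|.
Proof.
have [C MC] := cluster_M_le; exists C => i iA; apply: filterS MC => h.
exact/le_trans/z_le_M.
Qed.

(** These are the coefficients in [w] of [(P h).[h * w] / h ^+ k]. For [j <= k] the coefficient of
    [P h] is [O(h ^+ (k - j))] and has an expansion of that order; for [j > k] a positive power of
    [h] remains. *)
Let coef_cvg j : (j <= n)%N -> exists c : R, (P h)`_j * h ^+ j / h ^+ k @[h --> (0 : R)^'] --> c.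
Proof.
move=> jn; have [K PK] := coef_cluster_le; have [C MC] := cluster_M_le.
have Pb : \forall h \near (0 : R)^', `|(P h)`_j| <= `|K| * `|C| ^+ (k - j) * `|h| ^+ (k - j).
  apply: filterS2 PK MC => h /(_ j jn) Ph Mh; apply: le_trans Ph _.
  rewrite -mulrA -exprMn; apply: (@le_trans _ _ (`|K| * M h ^+ (k - j))).
    by rewrite ler_wpM2r ?exprn_ge0// ler_norm.
  rewrite ler_wpM2l//; apply: lerXn2r; rewrite ?nnegrE ?mulr_ge0//.
  by apply: le_trans Mh _; rewrite ler_wpM2r// ler_norm.
have Pp : has_peano 0 (k - j) (fun h => (P h)`_j).
  by apply: has_peanoW (P_peano j); exact: leq_trans (leq_subr _ _) k_le_n.
have [c cP] := has_peano_quotient Pp Pb.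
have hc : h ^+ (j - k) @[h --> (0 : R)^'] --> (0 : R) ^+ (j - k).
  apply: cvg_within_filter; suff : {for (0 : R), continuous (fun h : R => h ^+ (j - k))} by [].
  exact: exprn_continuous.
exists (c * 0 ^+ (j - k)).
have cc : (P h)`_j / h ^+ (k - j) * h ^+ (j - k) @[h --> (0 : R)^'] --> c * 0 ^+ (j - k).
  by apply: cvgM.
apply: cvg_near_eq cc; have := nbhs_dnbhs_neq (0 : R); apply: filterS => h h0.
have [jk|kj] := leqP j k.
  have -> : (j - k = 0)%N by apply/eqP; rewrite subn_eq0.
  rewrite expr0 mulr1 -[in RHS](subnK jk) exprD invfM mulrACA.
  by rewrite mulfV ?expf_neq0// mulr1.
have -> : (k - j = 0)%N by apply/eqP; rewrite subn_eq0 ltnW.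
rewrite expr0 divr1 -[in h ^+ j](subnK (ltnW kj)) exprD -!mulrA.
by rewrite mulfV ?expf_neq0// mulr1.
Qed.

(** The value [(P h).[h * w] / h ^+ k] is the wanted product times the factor of the large roots,
    which tends to [rho != 0]. The limit is two-sided, so left and right slopes are read off the
    same [g]. *)
Lemma cluster_cvg : exists g : R -> R, forall w,
  \prod_(i in A) (w - z i h / h) @[h --> (0 : R)^'] --> g w.
Proof.
have ex j : exists c : R, (j <= n)%N -> (P h)`_j * h ^+ j / h ^+ k @[h --> (0 : R)^'] --> c.
  have [jn|nj] := leqP j n; last by exists 0.
  by have [c cP] := coef_cvg jn; exists c.
have [c cP] := choice ex.
exists (fun w => (\sum_(j < n.+1) c j * w ^+ j) / rho) => w.
have Gc : \sum_(j < n.+1) ((P h)`_j * h ^+ j / h ^+ k) * w ^+ j @[h --> (0 : R)^']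
    --> \sum_(j < n.+1) c j * w ^+ j.
  apply: cvg_big => [|j _]; first exact: add_continuous.
  by apply: cvgM; [apply: cP; rewrite -ltnS|exact: cvg_cst].
have qc : (\sum_(j < n.+1) ((P h)`_j * h ^+ j / h ^+ k) * w ^+ j) /
    \prod_(i in ~: A) (h * w - z i h) @[h --> (0 : R)^'] -->
    (\sum_(j < n.+1) c j * w ^+ j) / rho.
  by apply: cvgM Gc _; apply: cvgV; [exact: rho_neq0|exact: prod_large_cvg].
apply: cvg_near_eq qc.
have nz : \forall h \near (0 : R)^', \prod_(i in ~: A) (h * w - z i h) != 0.
  have /cvgrPdist_lt /(_ `|rho|) := @prod_large_cvg w; rewrite normr_gt0 => /(_ rho_neq0).
  apply: filterS => h; apply: contraTneq => ->.
  by rewrite subr0 ltxx.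
have := nbhs_dnbhs_neq (0 : R); move: nz; apply: filter_app2; near=> h => nz h0.
apply: (mulIf nz); rewrite divfK//.
have -> : \sum_(j < n.+1) ((P h)`_j * h ^+ j / h ^+ k) * w ^+ j = (P h).[h * w] / h ^+ k.
  have sP : size (P h) = n.+1.
    by rewrite /P size_prod_XsubC /index_enum -enumT size_enum_ord.
  rewrite horner_coef sP mulr_suml; apply: eq_bigr => j _.
  by rewrite exprMn; ring.
rewrite PE hornerM !horner_prod_XsubC mulrAC; congr (_ * _).
have -> : \prod_(i in A) (h * w - z i h) = \prod_(i in A) (h * (w - z i h / h)).
  by apply: eq_bigr => i _; field.
rewrite big_split /= prodr_const -/k mulrAC mulfV ?mul1r// expf_neq0//.
Unshelve. all: by end_near. Qed.

End Cluster.

(** * The sorted roots of [Pt] *)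

Lemma perm_of_perm_eq (X : eqType) n (f g : 'I_n -> X) :
  perm_eq [seq g i | i <- enum 'I_n] [seq f i | i <- enum 'I_n] ->
  exists p : {perm 'I_n}, forall i, f (p i) = g i.
Proof.
have -> : [seq f i | i <- enum 'I_n] = [tuple f i | i < n] by [].
move=> /tuple_permP[p E]; exists p => i.
have /(congr1 (fun s => nth (g i) s i)) := E.
rewrite (nth_map i) ?size_enum_ord// nth_ord_enum => ->.
by rewrite (nth_map i) ?size_enum_ord// nth_ord_enum tnth_mktuple.
Qed.

(** The multiplicity of a pair [(c, d)] is that of [d] over the fibre of [v] at [c]. *)
Lemma perm_eq_pairs (X Y : eqType) n (v : 'I_n -> X) (f g : 'I_n -> Y) :
  (forall c, perm_eq [seq f i | i <- enum [set i | v i == c]%SET]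
                     [seq g i | i <- enum [set i | v i == c]%SET]) ->
  perm_eq [seq (v i, f i) | i <- enum 'I_n] [seq (v i, g i) | i <- enum 'I_n].
Proof.
move=> fg; apply/allP => -[c d] _.
have cE (h : 'I_n -> Y) : count_mem (c, d) [seq (v i, h i) | i <- enum 'I_n] =
    count_mem d [seq h i | i <- enum [set i | v i == c]%SET].
  rewrite !count_map [in RHS]/enum_mem -enumT [RHS]count_filter; apply: eq_count => i /=.
  by rewrite inE xpair_eqE andbC.
by apply/eqP; rewrite !cE; have /seq.permP := fg c; apply.
Qed.

Section SortedRoots.
Variables (R : realType) (n : nat) (a : nat -> R -> R).
Hypothesis aC : forall i : nat, (1 <= i <= n)%N -> classC n (a i).
Hypothesis real_roots : forall t : R, all_roots_real (Pt n a t).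

Lemma size_Pt t : size (Pt n a t) = n.+1.
Proof.
rewrite /Pt size_polyDl size_polyXn// ltnS; apply: leq_trans (size_sum _ _ _) _.
apply/bigmax_leqP_seq => i; rewrite mem_index_iota ltnS => /andP[i1 i_le_n] _.
rewrite (leq_trans (size_scale_leq _ _))// size_polyXn ltn_subrL i1.
exact: leq_trans i1 i_le_n.
Qed.

Lemma sorted_root_functions : exists y : 'I_n -> R -> R,
  (forall t, Pt n a t = \prod_(i < n) ('X - (y i t)%:P)) /\
  forall (i j : 'I_n) t, (i <= j)%N -> y i t <= y j t.
Proof.
have ex t : exists r : seq R, size r = n /\ Pt n a t = \prod_(z <- r) ('X - z%:P).
  by have [r] := real_roots t; rewrite size_Pt => rn rP; exists r.
have [r rP] := choice ex; pose s t := sort <=%R (r t).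
have ss t : size (s t) = n by rewrite size_sort (rP t).1.
exists (fun i t => nth 0 (s t) i); split=> [t|i j t ij].
  rewrite (rP t).2 -(perm_big _ (permEl (perm_sort <=%R (r t)))) /= -/(s t).
  by rewrite (big_nth 0) ss big_mkord.
apply: (sorted_leq_nth le_trans le_refl) => //; rewrite ?inE ?ss//.
exact: sort_le_sorted.
Qed.

Variable y : 'I_n -> R -> R.
Hypothesis Py : forall t, Pt n a t = \prod_(i < n) ('X - (y i t)%:P).
Hypothesis y_sorted : forall (i j : 'I_n) t, (i <= j)%N -> y i t <= y j t.

Lemma coef_Pt_peano q j : has_peano q n (fun t => (Pt n a t)`_j).
Proof.
have -> : (fun t => (Pt n a t)`_j) = fun t => ('X^n : {poly R})`_j +
    \sum_(1 <= i < n.+1 | (1 <= i < n.+1)%N && true) ((-1) ^+ i * ('X^(n - i) : {poly R})`_j) * a i t.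
  apply/funext => t; rewrite /Pt coefD coef_sum big_nat_cond; congr (_ + _).
  by apply: eq_bigr => i _; rewrite coefZ mulrAC.
apply: has_peanoD; first exact: has_peano_cst.
apply: has_peano_sum => i; rewrite andbT ltnS => i1.
apply: has_peanoZ; exact/classC_has_peano/aC.
Qed.

(** Translating the roots by [v] is composition with ['X + v%:P], so each new coefficient is a fixed
    linear combination of the old ones. *)
Lemma coef_shift_peano q v j :
  has_peano 0 n (fun h => (\prod_(i < n) ('X - (y i (q + h) - v)%:P))`_j).
Proof.
have -> : (fun h => (\prod_(i < n) ('X - (y i (q + h) - v)%:P))`_j) =
    fun h => \sum_(i < n.+1) (('X + v%:P) ^+ i)`_j * (Pt n a (q + h))`_i.
  apply/funext => h.
  have -> : \prod_(i < n) ('X - (y i (q + h) - v)%:P) = Pt n a (q + h) \Po ('X + v%:P).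
    rewrite Py rmorph_prod /=; apply: eq_bigr => i _.
    by rewrite comp_polyB comp_polyX comp_polyC polyCB opprB addrA.
  rewrite comp_polyE size_Pt coef_sum; apply: eq_bigr => i _.
  by rewrite coefZ mulrC.
apply: has_peano_sum => i _; apply: has_peanoZ.
have [T fT] := coef_Pt_peano q i; exists T => e /fT.
by apply: filterS => h; rewrite add0r.
Qed.

Lemma coef_Pt_cvg q j : (Pt n a (q + h))`_j @[h --> (0 : R)] --> (Pt n a q)`_j.
Proof. exact: has_peano_continuous (coef_Pt_peano q j). Qed.

(** The sum of the squares of all roots is a polynomial in the coefficients, hence continuous at
    [q], and it bounds each square. *)
Lemma sorted_roots_bounded q : exists C, forall i,
  \forall h \near (0 : R), `|y i (q + h)| <= C.
Proof.
pose S t := (Pt n a t * 'X^2)`_n.+1 ^+ 2 - 2 * (Pt n a t * 'X^2)`_n.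
have SE t : S t = \sum_(i < n) y i t ^+ 2.
  have := coef_prod_XsubC_sqr [seq y i t | i <- enum 'I_n].
  rewrite size_map size_enum_ord !big_map -!enumT !big_enum /= => <-.
  by rewrite /S Py.
have Xc j : (Pt n a (q + h) * 'X^2)`_j @[h --> (0 : R)] --> (Pt n a q * 'X^2)`_j.
  rewrite coefMXn; case: ifPn => j2.
    apply: cvg_near_eq (cvg_cst 0); near=> h; by rewrite coefMXn j2.
  by apply: cvg_near_eq (@coef_Pt_cvg q (j - 2)); near=> h; rewrite coefMXn (negPf j2).
have Sc : S (q + h) @[h --> (0 : R)] --> S q.
  rewrite /S !expr2; apply: cvgB; first exact: cvgM.
  by apply: cvgM; [exact: cvg_cst|].
have /cvgrPdist_le /(_ 1 ltr01) Sb := Sc.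
(* Near [q] the squares are at most [S q + 1], and [w ^+ 2 <= s] implies [w <= 1 + s]. *)
exists (1 + (S q + 1)) => i; apply: filterS Sb => h.
rewrite ler_norml => /andP[Sh _].
have : y i (q + h) ^+ 2 <= S (q + h).
  by rewrite SE (bigD1 i)//= lerDl; apply: sumr_ge0 => j _; exact: sqr_ge0.
rewrite -[y i (q + h) ^+ 2]real_normK ?num_real//.
have := normr_ge0 (y i (q + h)); move: `|_| => w w0 ws.
nra.
Unshelve. all: by end_near. Qed.

Lemma horner_Pt_cvg q w : \prod_(i < n) (w - y i (q + h)) @[h --> (0 : R)] -->
  \prod_(i < n) (w - y i q).
Proof.
have E t : \prod_(i < n) (w - y i t) = \sum_(j < n.+1) (Pt n a t)`_j * w ^+ j.
  rewrite -[n.+1](size_Pt t) -horner_coef Py horner_prod.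
  by apply: eq_bigr => i _; rewrite hornerXsubC.
rewrite E; have Sc : \sum_(j < n.+1) (Pt n a (q + h))`_j * w ^+ j @[h --> (0 : R)] -->
    \sum_(j < n.+1) (Pt n a q)`_j * w ^+ j.
  apply: cvg_big => [|j _]; first exact: add_continuous.
  by apply: cvgM; [exact: coef_Pt_cvg|exact: cvg_cst].
by apply: cvg_near_eq Sc; near=> h; rewrite E.
Unshelve. all: by end_near. Qed.

(** The limits exist by boundedness and convergence of the polynomial; being sorted with the same
    product, they are the roots at [q]. *)
Lemma sorted_roots_continuous q i : y i (q + h) @[h --> (0 : R)] --> y i q.
Proof.
have [C yC] := sorted_roots_bounded q.
have setTE (F : 'I_n -> R) : \prod_(i in [set: 'I_n]%SET) F i = \prod_(i < n) F i.
  by apply: eq_bigl => j; rewrite inE.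
have [| | |l [lm lg lc]] := @sorted_roots_cvg R n [set: 'I_n]%SET R (nbhs (0 : R))
    (fun i h => y i (q + h)) C (fun w => \prod_(i < n) (w - y i q)) _.
- by move=> j _; exact: yC.
- by move=> j k _ _ jk; near=> h; exact: y_sorted.
- move=> w; apply: cvg_near_eq (@horner_Pt_cvg q w); near=> h.
  by rewrite setTE.
suff -> : y i q = l i by apply: lc; rewrite inE.
apply: (@sorted_roots_unique R n [set: 'I_n]%SET (fun i => y i q) l) => //.
- by move=> j k _ _; exact: y_sorted.
- by move=> w; rewrite lg setTE.
Unshelve. all: by end_near. Qed.

(** * One-sided slopes of the sorted roots *)

Lemma osd_of_cvg (f : R -> R) (v d : R) :
  (f h - v) / h @[h --> (0 : R)^'+] --> d -> osd f v d.
Proof.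
move=> /cvgrPdist_le fd e /fd fe; have h0 := @nbhs_right_gt R 0.
apply: filterS2 fe h0 => h fh h0.
have -> : f h - v - d * h = - ((d - (f h - v) / h) * h).
  by field; rewrite gt_eqF.
by rewrite normrN normrM (gtr0_norm h0) ler_wpM2r// ltW.
Qed.

(** On each side the difference quotients are sorted, bounded roots of a convergent polynomial, so
    they converge. The limit [g] is common to both sides, and both [dr] and [- dl] list its
    roots. *)
Lemma cluster_slopes q v (A := [set i | y i q == v]%SET) :
  exists dr dl : 'I_n -> R, [/\
    forall i, i \in A -> osd (fun h => y i (q + h)) v (dr i),
    forall i, i \in A -> osd (fun h => y i (q - h)) v (dl i) &
    perm_eq [seq - dl i | i <- enum A] [seq dr i | i <- enum A]].
Proof.
have [A0|[i0 i0A]] := set_0Vmem A.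
  by exists (fun=> 0), (fun=> 0); rewrite A0; split => [i|i|]; rewrite ?inE// enum_set0.
have A_gt0 : (0 < #|A|)%N by apply/card_gt0P; exists i0.
pose z i h := y i (q + h) - v.
have zc i : z i h @[h --> (0 : R)^'] --> y i q - v.
  apply: cvg_within_filter; apply: cvgB; last exact: cvg_cst.
  exact: sorted_roots_continuous.
have zs i : i \in A -> z i h @[h --> (0 : R)^'] --> (0 : R).
  by rewrite inE => /eqP iv; have := zc i; rewrite iv subrr.
have zl i : i \notin A -> z i h @[h --> (0 : R)^'] --> y i q - v by move=> _; exact: zc.
have b0 i : i \notin A -> y i q - v != 0 by rewrite inE subr_eq0.
have Pp j := @coef_shift_peano q v j.
have [C zC] := @cluster_le R n A z (fun i => y i q - v) A_gt0 zs zl b0 Pp.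
have [g gP] := @cluster_cvg R n A z (fun i => y i q - v) A_gt0 zs zl b0 Pp.
have hgt := @nbhs_right_gt R 0.
have [| | |dr [_ drg drc]] := @sorted_roots_cvg R n A R ((0 : R)^'+)
    (fun i h => z i h / h) C g _.
- move=> i iA; have [zr _] := dnbhs_right_left (zC i iA).
  apply: filterS2 zr hgt => h zh h0.
  by rewrite normrM normfV ler_pdivrMr ?normr_gt0 ?gt_eqF.
- move=> i j _ _ ij; apply: filterS hgt => h h0.
  by rewrite ler_pM2r ?invr_gt0// lerD2r y_sorted.
- by move=> w; apply: cvg_dnbhs_at_right; exact: gP.
have zN (P : R -> Prop) : (\forall h \near (0 : R)^', P h) -> \forall h \near (0 : R)^'+, P (- h).
  move=> /dnbhs_right_left[_]; rewrite nbhs_left0P; apply: filterS => h.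
  by rewrite sub0r.
(* The left quotients divide by [h] rather than [- h]; changing the sign in each of the [#|A|]
   factors gives this limit. *)
pose gl w := (-1) ^+ #|A| * g (- w).
have [| | |dl [_ dlg dlc]] := @sorted_roots_cvg R n A R ((0 : R)^'+)
    (fun i h => z i (- h) / h) C gl _.
- move=> i iA; apply: filterS2 (zN _ (zC i iA)) hgt => h zh h0.
  by rewrite normrM normfV ler_pdivrMr ?normr_gt0 ?gt_eqF// -[X in C * X]normrN.
- move=> i j _ _ ij; apply: filterS hgt => h h0.
  by rewrite ler_pM2r ?invr_gt0// lerD2r y_sorted.
- move=> w; rewrite /gl.
  have gc : (-1) ^+ #|A| * \prod_(i in A) (- w - z i (- h) / (- h)) @[h --> (0 : R)^'+] -->
      (-1) ^+ #|A| * g (- w).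
    apply: cvgM; first exact: cvg_cst.
    by move=> N /(gP (- w)) /zN.
  apply: cvg_near_eq gc; apply: filterS hgt => h h0.
  rewrite -prodr_const -big_split /=; apply: eq_bigr => i _.
  by field; rewrite gt_eqF.
exists dr, dl; split.
- by move=> i iA; apply: osd_of_cvg; exact: drc.
- by move=> i iA; apply: osd_of_cvg; exact: dlc.
apply: perm_eq_roots => w; rewrite drg.
have -> : \prod_(i in A) (w - - dl i) = (-1) ^+ #|A| * \prod_(i in A) (- w - dl i).
  rewrite -prodr_const -big_split /=; apply: eq_bigr => i _; ring.
by rewrite dlg /gl opprK mulrA -exprD addnn -mul2n exprM sqrrN !expr1n mul1r.
Qed.

(** The permutations inside the clusters are assembled by comparing multisets of pairs of a value at
    [q] and a slope. *)
Lemma sorted_roots_matched q : matched [set: 'I_n]%SET y q.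
Proof.
have [dr0 dr0P] := choice (cluster_slopes q).
have [dl0 dl0P] := choice dr0P.
(* Each branch takes its slopes from the cluster of its own value at [q]. *)
pose dr i := dr0 (y i q) i; pose dl i := dl0 (y i q) i.
have [p pP] : exists p : {perm 'I_n}, forall i, (y (p i) q, dr (p i)) = (y i q, - dl i).
  apply: (perm_of_perm_eq (f := fun i => (y i q, dr i)) (g := fun i => (y i q, - dl i))).
  apply: perm_eq_pairs => c; have [_ _] := dl0P c.
  have -> : [seq - dl i | i <- enum [set i | y i q == c]%SET] =
      [seq - dl0 c i | i <- enum [set i | y i q == c]%SET].
    by apply/eq_in_map => i; rewrite mem_enum inE => /eqP ic; rewrite /dl ic.
  have -> : [seq dr i | i <- enum [set i | y i q == c]%SET] =
      [seq dr0 c i | i <- enum [set i | y i q == c]%SET] => //.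
  by apply/eq_in_map => i; rewrite mem_enum inE => /eqP ic; rewrite /dr ic.
exists dr, dl, p; split.
- by move=> i; rewrite !inE.
- by move=> i _; have [+ _ _] := dl0P (y i q); apply; rewrite inE.
- by move=> i _; have [_ + _] := dl0P (y i q); apply; rewrite inE.
- by move=> i _; have [] := pP i.
Qed.

End SortedRoots.

(* Differentiable labelling of the roots *)
Local Close Scope classical_set_scope.

Theorem theorem4p3 (R : realType) (n : nat) (a : nat -> R -> R) :
  (forall i : nat, (1 <= i <= n)%N -> classC n (a i)) ->
  (forall t : R, all_roots_real (Pt n a t)) ->
  exists x : 'I_n -> R -> R,
    (forall (i : 'I_n) (t : R), derivable (x i) t 1) /\
    (forall t : R, Pt n a t = \prod_(i < n) ('X - (x i t)%:P)).
Proof.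
move=> aC real_roots.
have [y [Py y_sorted]] := sorted_root_functions real_roots.
have [s sP] := @matched_solution R _ y [set: 'I_n]%SET setT openT
  (fun q _ => sorted_roots_matched aC Py y_sorted q).
exists (fun i t => y (s t i) t); split=> [i t|t].
  by have [_] := sP t I; apply; rewrite inE.
(* At each [t] the functions are a permutation of the sorted roots, which leaves the product
   unchanged. *)
rewrite Py (reindex_inj (@perm_inj _ (s t))) /=.
by [].
Qed.
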